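(* Let $\mathcal D_n=\frac{1}{n!}\sum_{\pi\in S_n}\operatorname{sd}(\pi)$. Then \[\lambda\leq\liminf_{n\to\infty}\frac{\mathcal D_n}{n}\leq\limsup_{n\to\infty}\frac{\mathcal D_n}{n}\leq \frac{3}{5}(7-8\log 2),\] where $\lambda\approx 0.62433$ is the Golomb–Dickman constant.
   Context: A permutation is an ordering of a finite set of integers, written in one-line notation; $S_n$ is the set of permutations of $[n]=\{1,\ldots,n\}$. West's stack-sorting map $s$ is defined recursively: $s$ sends the empty permutation to itself, and if $\pi=LmR$ is nonempty with $m$ its largest entry ($L,R$ possibly empty), then $s(\pi)=s(L)\,s(R)\,m$ (concatenation). $s^t$ denotes the $t$-fold iterate of $s$. For $\pi\in S_n$, $\operatorname{sd}(\pi)$ is the smallest nonnegative integer $t$ such that $s^t(\pi)$ is the increasing permutation $123\cdots n$. The Golomb–Dickman constant is $\lambda=\lim_{n\to\infty}\alpha_n/n$, where $\alpha_n$ is the expected length of the longest cycle of a uniformly random permutation of $[n]$; equivalently $\lambda=\int_0^1 e^{\mathrm{li}(x)}dx$ with $\mathrm{li}(x)=\int_0^x dt/\log t$. *)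

(* Defs.v *)
From mathcomp Require Import all_boot all_order all_algebra all_fingroup.
From mathcomp Require Import all_classical all_reals all_analysis.

Set Implicit Arguments.
Unset Strict Implicit.
Unset Printing Implicit Defensive.

Import Order.TTheory GRing.Theory Num.Theory.
Import numFieldNormedType.Exports.

(* The argument k is fuel; [stack_sort] supplies enough of it, and
   [stack_sort0] and [stack_sort_split] below are West's recursive equations. *)
Fixpoint stack_sort_rec (k : nat) (w : seq nat) : seq nat :=
  match k, w with
  | k'.+1, _ :: _ =>
      let m := (\max_(x <- w) x)%N in
      let i := index m w in
      stack_sort_rec k' (take i w) ++ stack_sort_rec k' (drop i.+1 w) ++ [:: m]
  | _, _ => [::]
  end.

Definition stack_sort (w : seq nat) : seq nat := stack_sort_rec (size w) w.

Definition one_line (n : nat) (p : 'S_n) : seq nat :=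
  [seq (p i : nat).+1 | i <- enum 'I_n].

Section StackSortTheory.
Local Open Scope nat_scope.

Lemma stack_sort0 : stack_sort [::] = [::].
Proof. by []. Qed.

Lemma bigmax_seq_in (w : seq nat) : w != [::] -> \max_(x <- w) x \in w.
Proof.
elim: w => // a [|b w] IH _; first by rewrite big_seq1 inE.
rewrite big_cons inE; case: (leqP a (\max_(x <- b :: w) x)) => [|] le.
  by rewrite (IH isT) orbT.
by rewrite eqxx.
Qed.

Lemma stack_sort_rec_fuel k k' w : size w <= k -> size w <= k' ->
  stack_sort_rec k w = stack_sort_rec k' w.
Proof.
elim: k k' w => [|k IH] [|k'] [|a w] // sk sk'.
rewrite /stack_sort_rec -/stack_sort_rec.
set v := a :: w; set i := index _ v.
have iv : i < size v by rewrite index_mem bigmax_seq_in.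
have st : size (take i v) <= size w by rewrite size_take iv -ltnS.
have sd : size (drop i.+1 v) <= size w by rewrite size_drop subSS leq_subr.
rewrite (IH k' (take i v)) ?(leq_trans st) //.
by rewrite (IH k' (drop i.+1 v)) ?(leq_trans sd).
Qed.

Lemma stack_sort_split (L R : seq nat) (m : nat) :
  all (fun x => x < m) L -> all (fun x => x < m) R ->
  stack_sort (L ++ m :: R) = stack_sort L ++ stack_sort R ++ [:: m].
Proof.
move=> /allP hL /allP hR; set w := L ++ m :: R.
have maxE : \max_(x <- w) x = m.
  have mw : m \in w by rewrite mem_cat inE eqxx orbT.
  have wN0 : w != [::] by case: (w) mw.
  apply/eqP; rewrite eqn_leq; apply/andP; split.
    apply/bigmax_leqP_seq => x; rewrite mem_cat inE => /or3P[/hL/ltnW|/eqP->|/hR/ltnW] //.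
  exact: (@leq_bigmax_seq _ _ xpredT (fun x => x)).
have idxE : index m w = size L.
  rewrite index_cat; case: ifP => [/hL|_]; first by rewrite ltnn.
  by rewrite /= eqxx addn0.
have sw : size w = (size L + size R).+1 by rewrite size_cat /= addnS.
rewrite /stack_sort sw.
have -> : stack_sort_rec (size L + size R).+1 w =
    stack_sort_rec (size L + size R) (take (index (\max_(x <- w) x) w) w) ++
    stack_sort_rec (size L + size R) (drop (index (\max_(x <- w) x) w).+1 w) ++
    [:: \max_(x <- w) x] by case: (w) sw.
rewrite maxE idxE take_size_cat //.
rewrite /w -(cat_rcons m L R) drop_size_cat ?size_rcons //.
rewrite (@stack_sort_rec_fuel (size L + size R) (size L) L) ?leq_addr //.
by rewrite (@stack_sort_rec_fuel (size L + size R) (size R) R) ?leq_addl.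
Qed.

Lemma uniq_max_split (w : seq nat) : uniq w -> w != [::] ->
  exists L m R, [/\ w = L ++ m :: R, all (fun x => x < m) L
                  & all (fun x => x < m) R].
Proof.
move=> uw wN0; have mw := bigmax_seq_in wN0.
have le x : x \in w -> x <= \max_(x <- w) x.
  by move=> xw; exact: (@leq_bigmax_seq _ _ xpredT (fun x => x)).
move: (\max_(x <- w) x) mw le => m mw le.
case/splitPr: mw uw le => L R; rewrite cat_uniq /= => /and4P[_ nLR mR _] le.
exists L, m, R; split => //; apply/allP => x xI.
  rewrite ltn_neqAle le ?mem_cat ?xI // andbT; apply/eqP => xm.
  by move/negP: nLR; apply; rewrite -xm xI.
rewrite ltn_neqAle le ?mem_cat ?inE ?xI ?orbT // andbT; apply/eqP => xm.
by rewrite -xm xI in mR.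
Qed.

Lemma perm_stack_sort (w : seq nat) : uniq w -> perm_eq (stack_sort w) w.
Proof.
elim: {w}_.+1 {-2}w (ltnSn (size w)) => // k IH w sw uw.
have [->//|wN0] := eqVneq w [::].
have [L [m [R [wE hL hR]]]] := uniq_max_split uw wN0.
move: sw uw; rewrite wE size_cat /= addnS ltnS => sw.
rewrite cat_uniq /= => /and4P[uL _ _ uR].
rewrite stack_sort_split //; apply: perm_cat.
  by apply: IH => //; apply: leq_trans sw; rewrite ltnS leq_addr.
rewrite cats1 perm_rcons perm_cons.
by apply: IH => //; apply: leq_trans sw; rewrite ltnS leq_addl.
Qed.

Lemma stack_sort_cat (u v : seq nat) : sorted ltn v ->
  allrel ltn u v -> stack_sort (u ++ v) = stack_sort u ++ v.
Proof.
elim/last_ind: v => [|v x IH]; first by rewrite !cats0.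
move=> sv; rewrite -{1}cats1 allrel_catr allrel1r => /andP[uv ux].
rewrite -cats1 catA stack_sort_split //.
  rewrite IH //=; first by rewrite -catA.
  by apply: (subseq_sorted ltn_trans) sv; exact: subseq_rcons.
rewrite all_cat; apply/andP; split=> //.
by move: sv; rewrite (sorted_pairwise ltn_trans) pairwise_rcons => /andP[].
Qed.

Lemma sorted_iter_stack_sort (w v : seq nat) : uniq w -> sorted ltn v ->
  allrel ltn w v -> sorted ltn (iter (size w) stack_sort (w ++ v)).
Proof.
elim: {w}(size w) {-2}w v (erefl (size w)) => [|k IH] w v sw uw sv wv.
  by rewrite (size0nil sw).
rewrite sw iterSr stack_sort_cat //.
have wN0 : w != [::] by case: (w) sw.
have [L [m [R [wE hL hR]]]] := uniq_max_split uw wN0.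
have pw := perm_stack_sort uw.
have sE : stack_sort w = rcons (stack_sort L ++ stack_sort R) m.
  by rewrite wE stack_sort_split // catA cats1.
have := pw; rewrite sE => pr.
have su : size (stack_sort L ++ stack_sort R) = k.
  by have := perm_size pr; rewrite size_rcons sw => -[].
have ur : uniq (rcons (stack_sort L ++ stack_sort R) m) by rewrite (perm_uniq pr).
have mem_lt x : x \in stack_sort L ++ stack_sort R -> x < m.
  move=> xs; have : x \in w by rewrite -(perm_mem pr) mem_rcons inE xs orbT.
  rewrite wE mem_cat inE => /or3P[/(allP hL)|/eqP xm|/(allP hR)] //.
  by move: ur; rewrite rcons_uniq -xm xs.
have mw : m \in w by rewrite wE mem_cat inE eqxx orbT.
move/allrelP: wv => wv.
rewrite cat_rcons -[X in iter X]su; apply: IH => //.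
- by move: ur; rewrite rcons_uniq => /andP[].
- rewrite /= (path_sortedE ltn_trans) sv andbT.
  by apply/allP => y yv; apply: wv.
- apply/allrelP => x y xs; rewrite inE => /predU1P[->|yv]; first exact: mem_lt.
  by apply: wv => //; rewrite -(perm_mem pr) mem_rcons inE xs orbT.
Qed.

Lemma perm_one_line (n : nat) (p : 'S_n) : perm_eq (one_line p) (iota 1 n).
Proof.
have uo : uniq (one_line p).
  rewrite map_inj_uniq ?enum_uniq // => i j [] /val_inj; exact: perm_inj.
have so : size (one_line p) = n by rewrite size_map size_enum_ord.
have sub : {subset one_line p <= iota 1 n}.
  by move=> _ /mapP[i _ ->]; rewrite mem_iota add1n !ltnS leq0n ltn_ord.
apply: uniq_perm; rewrite ?iota_uniq //.
by have [] := uniq_min_size uo sub; rewrite ?size_iota ?so.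
Qed.

Lemma stack_sortable (n : nat) (p : 'S_n) :
  exists t, iter t stack_sort (one_line p) == iota 1 n.
Proof.
have pp := perm_one_line p.
have so : size (one_line p) = n by rewrite (perm_size pp) size_iota.
have uo : uniq (one_line p) by rewrite (perm_uniq pp) iota_uniq.
exists n; apply/eqP.
have pi t : perm_eq (iter t stack_sort (one_line p)) (iota 1 n).
  elim: t => // t IH; rewrite iterS; apply: perm_trans (IH).
  by apply: perm_stack_sort; rewrite (perm_uniq IH) iota_uniq.
apply: (irr_sorted_eq ltn_trans ltnn); last exact: perm_mem (pi n).
  have := @sorted_iter_stack_sort (one_line p) [::] uo isT.
  by rewrite cats0 so; apply; apply/allrelP.
exact: iota_ltn_sorted.
Qed.

End StackSortTheory.

Definition sd (n : nat) (p : 'S_n) : nat := ex_minn (stack_sortable p).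

Definition longest_cycle (n : nat) (p : 'S_n) : nat :=
  (\max_(C in porbits p) #|C|)%N.

Local Open Scope ring_scope.
Local Open Scope classical_set_scope.

Definition perm_mean (R : realType) (n : nat) (f : 'S_n -> nat) : R :=
  (n`!%:R)^-1 * \sum_(p : 'S_n) (f p)%:R.

Definition avg_sd (R : realType) (n : nat) : R := perm_mean R (@sd n).

Definition avg_longest_cycle (R : realType) (n : nat) : R :=
  perm_mean R (@longest_cycle n).

Definition golomb_dickman (R : realType) : R :=
  limn (fun n : nat => avg_longest_cycle R n / n%:R).

(* Main.v *)
Require Import Defs.
From mathcomp Require Import all_boot all_order all_algebra all_fingroup.
From mathcomp Require Import all_classical all_reals all_analysis.
From mathcomp Require Import zify ring lra.
Set Implicit Arguments.
Unset Strict Implicit.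
Unset Printing Implicit Defensive.
Import Order.TTheory GRing.Theory Num.Theory.
Import numFieldNormedType.Exports.

(** Write [s] for the stack-sorting map and [n] for the largest entry.

    Upper bound.  For a word [A b W] with [b] larger than all of [A] one has
    [s (A b W) = s A . s (b W)], and [s A] again ends with its maximum: the
    letters of a block ending with its maximum enter the rest of the word one at
    a time, in decreasing order.  If [pi = L n R] and for every [v] at most one
    more letter of [R] than of [L] is [>= v], then [L] and [R] get sorted
    simultaneously and [|L| + 1] steps suffice; otherwise the blocks of [R] are
    used recursively.  By the ballot theorem the condition fails with
    probability [r (r - 1) / ((l + 1) (l + 2))] for [l = |L|] and [r = |R|], and
    solving the resulting recursion gives the constant.

    Lower bound.  If a factor [B m] ends with its maximum [m] and is followed by
    a letter [a], each application of [s] moves at most one of the letters of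
    [B m] larger than [a] past [a].  Applied to the blocks cut out by the
    right-to-left maxima of a prefix of [pi] and to the minimum [a] of the last
    [k] letters, this bounds the sorting time below by the longest block of the
    prefix, minus a loss of mean at most [n / (k + 1)].  The longest block is
    distributed as the longest cycle. *)

(** * One pass of the stack-sorting map *)

Section StackSortWords.
Local Open Scope nat_scope.
Local Open Scope seq_scope.
Implicit Types (w A B C D L R T W X Y Z : seq nat).

Lemma mem_stack_sort w : uniq w -> stack_sort w =i w.
Proof. by move=> /perm_stack_sort/perm_mem. Qed.

Lemma uniq_stack_sort w : uniq w -> uniq (stack_sort w).
Proof. by move=> uw; rewrite (perm_uniq (perm_stack_sort uw)). Qed.

Lemma size_stack_sort w : uniq w -> size (stack_sort w) = size w.
Proof. by move=> /perm_stack_sort/perm_size. Qed.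

Lemma all_stack_sort (P : pred nat) w : uniq w ->
  all P (stack_sort w) = all P w.
Proof. by move=> uw; apply: perm_all; apply: perm_stack_sort. Qed.

Lemma count_stack_sort (P : pred nat) w : uniq w ->
  count P (stack_sort w) = count P w.
Proof. by move=> uw; apply: (seq.permP (perm_stack_sort uw)). Qed.

Lemma stack_sort_sorted w : sorted ltn w -> stack_sort w = w.
Proof. by move=> sw; rewrite -{1}[w]cat0s stack_sort_cat. Qed.

Lemma stack_sort_last_max w : uniq w -> w != [::] ->
  exists B b, [/\ stack_sort w = rcons B b, all (gtn b) B & b \in w].
Proof.
move=> uw wN0; have [L [m [R [wE hL hR]]]] := uniq_max_split uw wN0.
move: uw; rewrite wE cat_uniq /= => /and4P[uL _ _ uR].
exists (stack_sort L ++ stack_sort R), m; split.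
- by rewrite stack_sort_split // catA cats1.
- by rewrite all_cat !all_stack_sort // hL.
- by rewrite mem_cat inE eqxx orbT.
Qed.

Lemma all_gtn_trans a b w : a <= b -> all (gtn a) w -> all (gtn b) w.
Proof. by move=> ab; apply: sub_all => x /= /leq_trans; apply. Qed.

(** The letters of [D] wait on the stack below those of [Y], and the first letter of [W], or the end
    of the input, pops all of [Y] before any letter of [D] can leave. The induction removes the
    maximum, which is the head of [D] or lies in [W] unless both are empty. *)
Lemma stack_sort_pull D Y W : uniq (D ++ Y ++ W) -> sorted gtn D ->
  allrel ltn Y D -> (W == [::]) || all (gtn (head 0 W)) Y ->
  stack_sort (D ++ Y ++ W) = stack_sort Y ++ stack_sort (D ++ W).
Proof.
elim: {D W}_.+1 {-2}D {-2}W (ltnSn (size (D ++ W))) => // k IH D W sz uw sD YD hW.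
have [/eqP|wN0] := eqVneq (D ++ Y ++ W) [::].
  by rewrite -nilpE /nilp !size_cat !addn_eq0 !size_eq0 => /and3P[/eqP-> /eqP-> /eqP->].
have [L [m [S [wE hL hS]]]] := uniq_max_split uw wN0.
have lem x : x \in D ++ Y ++ W -> x <= m.
  rewrite wE mem_cat inE => /or3P[/(allP hL)/ltnW|/eqP->|/(allP hS)/ltnW] //.
case: D sz uw sD YD wE lem {wN0} => [|d D] sz uw sD YD wE lem.
  have [->|WN0] := eqVneq W [::]; first by rewrite /= !cats0.
  have hY : all (gtn (head 0 W)) Y by case/orP: hW => // /eqP W0; rewrite W0 in WN0.
  have hin : head 0 W \in W by case: (W) WN0 => //= x W' _; rewrite inE eqxx.
  have mZ : m \in W.
    have : m \in Y ++ W by rewrite /= in wE; rewrite wE mem_cat inE eqxx orbT.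
    rewrite mem_cat => /orP[mY|//]; have := allP hY _ mY => /=.
    by have := lem (head 0 W); rewrite !mem_cat hin !orbT => /(_ isT); clear; lia.
  have [Z1 [Z2 ZE]] : exists Z1 Z2, W = Z1 ++ m :: Z2.
    by case/splitPr: mZ => Z1 Z2; exists Z1, Z2.
  move: uw; rewrite /= ZE cat_uniq cat_uniq /= => /and4P[uY nYZ uZ1 /and3P[nZ mZ2 uZ2]].
  have lt1 : all (fun x => x < m) Z1.
    apply/allP => y yZ; have := lem y; rewrite ZE !mem_cat yZ orbT => /(_ isT).
    rewrite leq_eqVlt => /predU1P[ym|//].
    by move: nZ; rewrite -ym yZ.
  have lt2 : all (fun x => x < m) Z2.
    apply/allP => y yZ; have := lem y; rewrite ZE !mem_cat in_cons yZ !orbT => /(_ isT).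
    rewrite leq_eqVlt => /predU1P[ym|//].
    by move: mZ2; rewrite -ym yZ.
  have ltY : all (fun x => x < m) Y.
    apply/allP => y yY; have := lem y; rewrite /= mem_cat yY => /(_ isT).
    rewrite leq_eqVlt => /predU1P[ym|//].
    by move/hasPn: nYZ => /(_ m); rewrite mem_cat inE eqxx orbT -ym yY => /(_ isT).
  rewrite catA !stack_sort_split ?all_cat ?ltY //.
  have := IH [::] Z1; rewrite /= => -> //.
  - by rewrite -catA.
  - by move: sz; rewrite /= ZE size_cat /=; clear; lia.
  - rewrite cat_uniq uY uZ1 /= andbT; apply: contra nYZ => /hasP[y y1 y2].
    by apply/hasP; exists y; rewrite // mem_cat y1.
  - by move: hY; rewrite ZE; case: (Z1).
have lt_path x : x \in D -> x < d.
  move=> xD; move: sD; rewrite /= (path_sortedE (rev_trans ltn_trans)) => /andP[/allP/(_ _ xD)] //.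
have ltd x : x \in D ++ Y -> x < d.
  rewrite mem_cat => /orP[/lt_path//|xY].
  by move/allrelP: YD => /(_ x d xY); rewrite inE eqxx; apply.
have uw' : uniq (D ++ Y ++ W) by move: uw => /= /andP[].
have sD' : sorted gtn D by apply: path_sorted sD.
have YD' : allrel ltn Y D.
  by apply/allrelP => x y xY yD; move/allrelP: YD; apply; rewrite // inE yD orbT.
have : m \in (d :: D) ++ Y ++ W by rewrite wE mem_cat inE eqxx orbT.
rewrite catA mem_cat => /orP[mDY|mW].
  have dm : d = m.
    apply/eqP; rewrite eqn_leq lem ?inE ?eqxx //=.
    by move: mDY; rewrite inE => /predU1P[->//|/ltd/ltnW].
  have ltW x : x \in D ++ Y ++ W -> x < d.
    move=> xI; have := lem x; rewrite /= inE xI orbT -dm => /(_ isT).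
    rewrite leq_eqVlt => /predU1P[xd|//].
    by move: uw; rewrite /= -xd xI.
  have -> : ((d :: D) ++ Y) ++ W = [::] ++ d :: (D ++ Y ++ W) by rewrite /= -catA.
  have -> : (d :: D) ++ W = [::] ++ d :: (D ++ W) by [].
  rewrite !stack_sort_split //=; first 1 last.
  - by apply/allP => x xI; apply: ltW; move: xI; rewrite !mem_cat => /orP[]->; rewrite ?orbT.
  - by apply/allP => x /ltW.
  by rewrite IH // ?catA //; move: sz; rewrite !size_cat /=; clear; lia.
have hY : all (gtn (head 0 W)) Y by case/orP: hW => // /eqP W0; rewrite W0 in mW.
have [Z1 [Z2 ZE]] : exists Z1 Z2, W = Z1 ++ m :: Z2.
  by case/splitPr: mW => Z1 Z2; exists Z1, Z2.
have um : uniq (((d :: D) ++ Y ++ Z1) ++ m :: Z2) by rewrite -!catA -ZE.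
have ltm y : y \in ((d :: D) ++ Y ++ Z1) ++ Z2 -> y < m.
  move=> yI; have := lem y; rewrite ZE.
  have -> : (d :: D) ++ Y ++ Z1 ++ m :: Z2 = ((d :: D) ++ Y ++ Z1) ++ m :: Z2 by rewrite -!catA.
  have -> : y \in ((d :: D) ++ Y ++ Z1) ++ m :: Z2.
    by move: yI; rewrite !mem_cat (in_cons m) => /orP[]->; rewrite ?orbT.
  move=> /(_ isT); rewrite leq_eqVlt => /predU1P[ym|//].
  have := um; rewrite -cat_rcons cat_uniq rcons_uniq => /and3P[/andP[m1 _] /hasPn m2 _].
  move: yI; rewrite ym mem_cat (negPf m1) => /m2.
  by rewrite mem_rcons inE eqxx.
rewrite ZE.
have -> : ((d :: D) ++ Y) ++ Z1 ++ m :: Z2 = ((d :: D) ++ Y ++ Z1) ++ m :: Z2 by rewrite -!catA.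
have -> : (d :: D) ++ Z1 ++ m :: Z2 = ((d :: D) ++ Z1) ++ m :: Z2 by rewrite -!catA.
have a1 : all (fun x => x < m) ((d :: D) ++ Y ++ Z1).
  by apply/allP => y yI; apply: ltm; rewrite mem_cat yI.
have a2 : all (fun x => x < m) Z2.
  by apply/allP => y yI; apply: ltm; rewrite mem_cat yI orbT.
have a3 : all (fun x => x < m) ((d :: D) ++ Z1).
  by move: a1; rewrite !all_cat => /and3P[-> _ ->].
rewrite !stack_sort_split // IH ?catA //.
- by move: sz; rewrite ZE !size_cat /=; clear; lia.
- by move: um; rewrite cat_uniq -catA => /andP[].
- by move: hY; rewrite ZE; case: (Z1).
Qed.

End StackSortWords.

(** * Certificates bounding the number of passes from above *)

Section UpperWords.
Local Open Scope nat_scope.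
Local Open Scope seq_scope.
Implicit Types (w A B C D L R T W X Y Z : seq nat).

Lemma sorted_ltn_rcons w x : sorted ltn w -> all (gtn x) w -> sorted ltn (rcons w x).
Proof.
by rewrite !(sorted_pairwise ltn_trans) pairwise_rcons => -> /= ->.
Qed.

(** Such a word avoids the pattern 231. Its maximum is the first letter of [D] or the last of [T],
    and removing it keeps the shape. *)
Lemma stack_sort_dec_inc D T : uniq (D ++ T) -> sorted gtn D -> sorted ltn T ->
  sorted ltn (stack_sort (D ++ T)).
Proof.
elim: {D T}_.+1 {-2}D {-2}T (ltnSn (size (D ++ T))) => // k IH D T sz u sD sT.
case: D sz u sD => [|d D] sz u sD; first by rewrite stack_sort_sorted.
have sD' : sorted gtn D by apply: path_sorted sD.
have ltD : all (gtn d) D.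
  by move: sD; rewrite /= (path_sortedE (rev_trans ltn_trans)) => /andP[].
case/lastP: T sz u sT => [|T x] sz u sT.
  rewrite cats0 in sz u *.
  have := IH D [::]; rewrite cats0 => /(_ sz _ sD' isT) sD1.
  have uD : uniq D by move: u => /andP[].
  rewrite -(cat0s (d :: D)) stack_sort_split //= cats1.
  by rewrite sorted_ltn_rcons ?sD1 // all_stack_sort.
have ltT : all (gtn x) T.
  by move: sT; rewrite (sorted_pairwise ltn_trans) pairwise_rcons => /andP[].
have sT' : sorted ltn T by apply: (subseq_sorted ltn_trans) sT; exact: subseq_rcons.
have [dx|xd] := ltnP x d.
  have lt : all (gtn d) (D ++ rcons T x).
    rewrite all_cat ltD all_rcons /= dx /=; apply: all_gtn_trans ltT; exact: ltnW.
  have uD : uniq (D ++ rcons T x) by move: u => /= /andP[].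
  rewrite -(cat0s ((d :: D) ++ _)) stack_sort_split //= cats1.
  by rewrite sorted_ltn_rcons ?all_stack_sort // IH.
have dx : d < x.
  rewrite ltn_neqAle xd andbT; apply: contraTneq u => ->.
  by rewrite /= mem_cat mem_rcons inE eqxx orbT.
have lt : all (gtn x) ((d :: D) ++ T).
  by rewrite all_cat ltT andbT /= dx; apply: all_gtn_trans ltD; exact: ltnW.
have uD : uniq ((d :: D) ++ T).
  by move: u; rewrite -rcons_cat rcons_uniq => /andP[].
rewrite -cats1 catA stack_sort_split // stack_sort0 cat0s cats1.
by rewrite sorted_ltn_rcons ?all_stack_sort // IH //; move: sz; rewrite -rcons_cat size_rcons.
Qed.

Definition ends_max A := all (geq (last 0 A)) A.

Lemma ends_max_stack_sort w : uniq w -> ends_max (stack_sort w).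
Proof.
move=> uw; have [->//|wN0] := eqVneq w [::].
have [B [b [-> Bb _]]] := stack_sort_last_max uw wN0.
by rewrite /ends_max last_rcons all_rcons /= leqnn; apply: sub_all Bb => x /ltnW.
Qed.

Lemma ends_max_rcons A a : uniq (rcons A a) -> ends_max (rcons A a) -> all (gtn a) A.
Proof.
rewrite rcons_uniq /ends_max last_rcons all_rcons => /andP[aA _] /andP[_ /allP h].
apply/allP => x xA /=; rewrite ltn_neqAle (h _ xA : x <= a) andbT.
by apply: contraNneq aA => <-.
Qed.

(* [sort_cost k W] certifies that [k] steps sort [W] (see [sort_cost_iter]).  In
   [cost_ballot] the letters of [T] need not be larger than those of [A]. *)
Inductive sort_cost : nat -> seq nat -> Prop :=
| cost_ballot A C T : ends_max A -> sorted ltn T -> allrel ltn C T ->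
    (forall v, count (leq v) C <= count (leq v) A) ->
    sort_cost (size A) (A ++ C ++ T)
| cost_block A W k : ends_max A -> sort_cost k W -> sort_cost (size A + k) (A ++ W).

Lemma sort_cost_sorted W : sorted ltn W -> sort_cost 0 W.
Proof. by move=> sW; exact: (@cost_ballot [::] [::] W). Qed.

Lemma sort_cost0 k W : sort_cost k W -> k = 0 -> sorted ltn W.
Proof.
elim=> {k W} [A C T _ sT _ h A0|A W k _ _ IH Ak0].
  have -> : A = [::] by apply/size0nil.
  (* The threshold 0 compares the lengths of [C] and [A]. *)
  have := h 0; rewrite !count_predT A0 leqn0 size_eq0 => /eqP ->.
  exact: sT.
have /size0nil -> : size A = 0 by move: Ak0; clear; lia.
by apply: IH; move: Ak0; clear; lia.
Qed.

Lemma sort_cost_rcons k W x : sort_cost k W -> all (gtn x) W -> sort_cost k (rcons W x).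
Proof.
elim=> {k W} [A C T eA sT CT h|A W k eA _ IH]; rewrite !all_cat.
  case/and3P=> [xA xC xT]; rewrite !rcons_cat; apply: cost_ballot => //.
    exact: sorted_ltn_rcons.
  by rewrite -cats1 allrel_catr CT allrel1r xC.
by case/andP => _ xW; rewrite rcons_cat; apply: cost_block => //; apply: IH.
Qed.

(** When [b] is read while [D] is on the stack, [D2] is popped and [D1] stays, with [b] on top of
    it. *)
Lemma sorted_gtn_split D b : sorted gtn D -> b \notin D ->
  exists D1 D2, [/\ D = D1 ++ D2, all (ltn b) D1, all (gtn b) D2,
    sorted gtn (rcons D1 b) & sorted gtn D2].
Proof.
move=> sD bD.
exists [seq x <- D | b < x], [seq x <- D | x < b].
have tr : transitive gtn by exact: rev_trans ltn_trans.
split; rewrite ?filter_all //.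
- elim: D sD bD => //= d D IH sD; rewrite inE negb_or => /andP[bd bD].
  have [lt|gt|e] := ltngtP b d; last by rewrite e eqxx in bd.
    by rewrite cat_cons -IH // (path_sorted sD).
  have -> : [seq x <- D | b < x] = [::].
    apply/eqP; rewrite -(negbK (_ == _)) -has_filter; apply/hasPn => x xD.
    move: sD; rewrite (path_sortedE tr) => /andP[/allP/(_ _ xD) /= dx _].
    by rewrite -leqNgt; move: gt dx; clear; lia.
  rewrite /=; congr cons.
  have /all_filterP -> // : all (fun x => x < b) D.
  apply/allP => x xD; move: sD; rewrite (path_sortedE tr) => /andP[/allP/(_ _ xD) /= dx _].
  by move: gt dx; clear; lia.
- rewrite (sorted_pairwise tr) pairwise_rcons filter_all /= -(sorted_pairwise tr).
  exact: sorted_filter.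
- exact: sorted_filter.
Qed.

(* Sorting [D1 D2 B b W] with [D1 > b > D2, B]: the letter [b] flushes [D2 B],
   while [D1] stays at the bottom of the stack. *)
Lemma stack_sort_flush D1 D2 B b W : uniq ((D1 ++ D2) ++ rcons B b ++ W) ->
  all (ltn b) D1 -> all (gtn b) D2 -> all (gtn b) B -> sorted gtn (rcons D1 b) ->
  stack_sort ((D1 ++ D2) ++ rcons B b ++ W) =
    stack_sort (D2 ++ B) ++ stack_sort (rcons D1 b ++ W).
Proof.
move=> u bD1 D2b Bb sD.
have E : (D1 ++ D2) ++ rcons B b ++ W = D1 ++ (D2 ++ B) ++ (b :: W).
  by rewrite cat_rcons -!catA.
rewrite E in u *; rewrite stack_sort_pull //; first by rewrite cat_rcons.
- by apply: (subseq_sorted (rev_trans ltn_trans)) sD; exact: subseq_rcons.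
- apply/allrelP => x y; rewrite mem_cat => xI /(allP bD1) /= yb.
  by apply: ltn_trans yb; case/orP: xI => [/(allP D2b)|/(allP Bb)].
- by rewrite /= all_cat D2b.
Qed.

(* The letters of a decreasing word [D] put in front of [W] model the letters of
   earlier blocks which enter [W] one step at a time. *)
Lemma sort_cost_step k W D : sort_cost k W -> uniq (D ++ W) -> sorted gtn D ->
  exists2 k', sort_cost k' (stack_sort (D ++ W))
            & k' <= (if k is k0.+1 then k0 + size D else 0).
Proof.
move=> cW; elim: cW D => {k W} [A C T eA sT CT h|A W k eA cW IH] D u sD.
  case/lastP: A eA h u => [|B b] eA h u.
    (* Without a block, [C] is empty too, and one pass sorts [D ++ T]. *)
    have C0 : C = [::].
      by have := h 0; rewrite !count_predT leqn0 size_eq0 => /eqP.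
    exists 0 => //; rewrite C0 /= in u *.
    exact/sort_cost_sorted/stack_sort_dec_inc.
  have uB : uniq (rcons B b) by move: u; rewrite !cat_uniq => /and5P[].
  have Bb := ends_max_rcons uB eA.
  have bD : b \notin D.
    move: u; rewrite cat_uniq => /and3P[_ /hasPn/(_ b) + _]; apply.
    by rewrite mem_cat mem_rcons inE eqxx.
  have [D1 [D2 [DE bD1 D2b sD1 sD2]]] := sorted_gtn_split sD bD.
  rewrite DE in u *; rewrite stack_sort_flush //.
  (* A letter of [C] above [b] would be a threshold that no letter of [A] reaches. *)
  have Cb : all (gtn b) C.
    apply/allP => x xC /=; rewrite ltnNge; apply/negP => bx.
    have neq : b != x.
      apply: contraTneq u => bx'; rewrite catA cat_uniq; apply/negP => /and3P[_ /hasPn nh _].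
      have := nh x; rewrite mem_cat xC => /(_ isT).
      by rewrite -bx' mem_cat mem_rcons inE eqxx !orbT.
    have lt : b < x by rewrite ltn_neqAle neq.
    have := h x; rewrite -cats1 count_cat /= [x <= b]leqNgt lt /= !addn0.
    have -> : count (leq x) B = 0.
      apply/eqP; rewrite -leqn0 leqNgt -has_count -all_predC.
      by apply: sub_all Bb => y /= yb; rewrite -ltnNge; move: lt yb; clear; lia.
    rewrite leqn0 => /eqP; move: xC; case/splitPr => C1 C2.
    by rewrite count_cat /= leqnn; clear; lia.
  have uu : uniq (rcons D1 b ++ C ++ T).
    apply: subseq_uniq u; rewrite -!cats1 -!catA; apply: cat_subseq => //.
    by apply: subseq_trans (suffix_subseq D2 _); exact: (suffix_subseq B).
  have uC : uniq C by move: uu; rewrite !cat_uniq => /and5P[].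
  have uDB : uniq (D2 ++ B).
    apply: subseq_uniq u; rewrite -cats1 -!catA; apply: subseq_trans (suffix_subseq D1 _).
    by apply: cat_subseq => //; exact: prefix_subseq.
  have CD1 : allrel ltn C (rcons D1 b).
    apply/allrelP => x y xC; rewrite mem_rcons inE => /predU1P[->|yD].
      exact: (allP Cb).
    by apply: ltn_trans (allP bD1 _ yD); exact: (allP Cb).
  have hT : (T == [::]) || all (gtn (head 0 T)) C.
    case: T CT {sT u uu} => //= t T CT; apply/allP => x xC /=.
    by move/allrelP: CT; apply => //; rewrite inE eqxx.
  have sDT : sorted ltn (stack_sort (rcons D1 b ++ T)).
    apply: stack_sort_dec_inc => //.
    by apply: subseq_uniq uu; apply: cat_subseq => //; exact: suffix_subseq.
  have uDT : uniq (rcons D1 b ++ T).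
    by apply: subseq_uniq uu; apply: cat_subseq => //; exact: suffix_subseq.
  rewrite stack_sort_pull //; set T' := stack_sort (rcons D1 b ++ T).
  have CT' : allrel ltn C T'.
    apply/allrelP => x y xC; rewrite /T' mem_stack_sort // mem_cat => /orP[] yI.
      exact: (allrelP CD1).
    exact: (allrelP CT).
  exists (size (D2 ++ B)); last by rewrite size_rcons !size_cat; clear; lia.
  rewrite -[size _](size_stack_sort uDB).
  have [C0|CN0] := eqVneq C [::].
    rewrite C0 /=; apply: (@cost_ballot _ [::]) => //; exact: ends_max_stack_sort.
  (* The block loses [b] and [C] loses its maximum [c] to the sorted tail. Both counts drop by one
     for [v <= c], and no letter of [C'] reaches a larger [v]. *)
  have [C' [c [CE C'c cC]]] := stack_sort_last_max uC CN0.
  rewrite CE cat_rcons; apply: cost_ballot.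
  - exact: ends_max_stack_sort.
  - rewrite /= (path_sortedE ltn_trans) sDT andbT.
    by apply/allP => y yT; exact: (allrelP CT').
  - have sub x : x \in C' -> x \in C.
      by move=> xC; rewrite -(mem_stack_sort uC) CE mem_rcons inE xC orbT.
    apply/allrelP => x y xC; rewrite inE => /predU1P[->|yT]; first exact: (allP C'c).
    by apply: (allrelP CT') => //; exact: sub.
  - move=> v; rewrite count_stack_sort // count_cat.
    have := h v; rewrite -(count_stack_sort _ uC) CE -!cats1 !count_cat /= !addn0.
    have := allP Cb _ cC => /= cb'.
    case: (leqP v c) => vc; first by rewrite (leq_trans vc (ltnW cb')); clear; lia.
    have -> : count (leq v) C' = 0; last by [].
    apply/eqP; rewrite -leqn0 leqNgt -has_count -all_predC.
    by apply: sub_all C'c => y /= yb; rewrite -ltnNge; move: vc yb; clear; lia.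
case/lastP: A eA u => [|B b] eA u; first exact: IH.
have uB : uniq (rcons B b) by move: u; rewrite !cat_uniq => /and5P[].
have Bb := ends_max_rcons uB eA.
have bD : b \notin D.
  move: u; rewrite cat_uniq => /and3P[_ /hasPn/(_ b) + _]; apply.
  by rewrite mem_cat mem_rcons inE eqxx.
have [D1 [D2 [DE bD1 D2b sD1 sD2]]] := sorted_gtn_split sD bD.
rewrite DE in u *; rewrite stack_sort_flush //.
have uDB : uniq (D2 ++ B).
  apply: subseq_uniq u; rewrite -cats1 -!catA; apply: subseq_trans (suffix_subseq D1 _).
  by apply: cat_subseq => //; exact: prefix_subseq.
have uu : uniq (rcons D1 b ++ W).
  apply: subseq_uniq u; rewrite -!cats1 -!catA; apply: cat_subseq => //.
  by apply: subseq_trans (suffix_subseq D2 _); exact: (suffix_subseq B).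
(* Now [rcons D1 b] precedes [W], so the rest costs at most [k + size D1], while the new block has
   [size D2 + size B] letters. In total this is at most the old cost plus the size of [D], minus
   one. *)
have [k' ck' lek'] := IH _ uu sD1.
exists (size (stack_sort (D2 ++ B)) + k').
  by apply: cost_block => //; exact: ends_max_stack_sort.
rewrite size_stack_sort // !size_cat !size_rcons /=.
by case: k {IH cW} lek' => [|k]; rewrite ?size_rcons; clear; lia.
Qed.

Lemma sorted_iter_stack_sort_id w t : sorted ltn w -> iter t stack_sort w = w.
Proof. by move=> sw; elim: t => //= t ->; exact: stack_sort_sorted. Qed.

(** With [D] empty each pass lowers a positive cost by at least one; passes left over act on a
    sorted word. *)
Lemma sort_cost_iter k W : sort_cost k W -> uniq W -> sorted ltn (iter k stack_sort W).
Proof.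
elim/ltn_ind: k W => -[_ W /sort_cost0-> //|k IH W cW uW].
have [k' ck' lek'] := sort_cost_step (D := [::]) cW uW isT.
rewrite iterSr; have le : k' <= k by move: lek'; rewrite addn0.
have sk : sorted ltn (iter k' stack_sort (stack_sort W)).
  by apply: IH => //; exact: uniq_stack_sort.
by rewrite -(subnK le) iterD sorted_iter_stack_sort_id.
Qed.

(** The slack of one pays for the maximum of [R], which goes into the sorted tail of
    [cost_ballot]. *)
Definition ballot L R : Prop := forall v, count (leq v) R <= (count (leq v) L).+1.

(* [acc] is the part of the current block read so far. *)
Fixpoint merge_bound acc w : nat :=
  if w is x :: w' then
    if all (gtn x) w' then
      if `[< ballot acc w' >] then size acc else size acc + merge_bound [::] w'
    else merge_bound (rcons acc x) w'
  else 0.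

(** The first letter larger than everything after it is the maximum, so the scan stops exactly at
    [m]. *)
Lemma merge_bound_split acc L m R : all (gtn m) L -> all (gtn m) R ->
  merge_bound acc (L ++ m :: R) =
    if `[< ballot (acc ++ L) R >] then size acc + size L
    else size acc + size L + merge_bound [::] R.
Proof.
move=> + mR; elim: L acc => [|x L IH] acc /=; first by rewrite mR cats0 addn0.
case/andP=> xm Lm; rewrite all_cat /= [m < x]ltnNge ltnW //= andbF IH //.
by rewrite cat_rcons size_rcons addSnnS.
Qed.

Lemma merge_bound_le acc w : w != [::] -> merge_bound acc w <= size acc + (size w).-1.
Proof.
elim: w acc => //= x w IH acc _.
have [->|wN0] := eqVneq w [::].
  by case: ifP => _ /=; rewrite ?addn0 //; case: ifP => _; rewrite ?addn0.
case: ifP => _.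
  case: ifP => _; first exact: leq_addr.
  by rewrite leq_add2l (leq_trans (IH _ wN0)) // leq_pred.
rewrite (leq_trans (IH _ wN0)) // size_rcons.
by case: (w) wN0 => //= *; rewrite addSnnS.
Qed.

(** After one pass both factors of [s L . s R . m] end with their maxima. Under [ballot] the maximum
    of [s R] becomes the tail and the rest of [s R] becomes [C]; otherwise [s L] is a block in front
    of the certificate for [s R]. The final [m] never moves. *)
Lemma sort_cost_stack_sort w : uniq w -> sort_cost (merge_bound [::] w) (stack_sort w).
Proof.
elim: {w}_.+1 {-2}w (ltnSn (size w)) => // k IH w sw uw.
have [->|wN0] := eqVneq w [::]; first exact: sort_cost_sorted.
have [L [m [R [wE hL hR]]]] := uniq_max_split uw wN0.
move: sw uw; rewrite wE size_cat /= addnS ltnS => sw.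
rewrite cat_uniq /= => /and4P[uL _ _ uR].
rewrite stack_sort_split // merge_bound_split //= !add0n -[size L](size_stack_sort uL).
have [RE|RN0] := eqVneq R [::].
  rewrite RE /= cats1 addn0 if_same; apply: sort_cost_rcons; last by rewrite all_stack_sort.
  rewrite -{2}[stack_sort L]cats0.
  rewrite -[size _]addn0; apply: cost_block; first exact: ends_max_stack_sort.
  exact: sort_cost_sorted.
case: asboolP => bLR; rewrite catA cats1.
  apply: sort_cost_rcons; last by rewrite all_cat !all_stack_sort // hL.
  have [C [c [CE Cc cR]]] := stack_sort_last_max uR RN0.
  rewrite CE -cats1; apply: cost_ballot => //.
  - exact: ends_max_stack_sort.
  - by apply/allrelP => x y xC; rewrite inE => /eqP ->; exact: (allP Cc).
  - move=> v; rewrite count_stack_sort //; have := bLR v.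
    rewrite -(count_stack_sort _ uR) CE -cats1 count_cat /= addn0.
    case: (leqP v c) => vc; first by rewrite addn1 ltnS.
    have -> // : count (leq v) C = 0.
    apply/eqP; rewrite -leqn0 leqNgt -has_count -all_predC.
    by apply: sub_all Cc => y /= yb; rewrite -ltnNge; move: vc yb; clear; lia.
apply: sort_cost_rcons; last by rewrite all_cat !all_stack_sort // hL.
apply: cost_block; first exact: ends_max_stack_sort.
by apply: IH => //; move: sw; clear; lia.
Qed.

(** The additional step is the first pass, which brings the word into the shape that [sort_cost]
    describes. *)
Lemma sorted_merge_bound w : uniq w ->
  sorted ltn (iter (merge_bound [::] w).+1 stack_sort w).
Proof.
move=> uw; rewrite iterSr; apply: sort_cost_iter; last exact: uniq_stack_sort.
exact: sort_cost_stack_sort.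
Qed.

End UpperWords.

(** * Long blocks force many passes *)

Section LowerWords.
Local Open Scope nat_scope.
Local Open Scope seq_scope.
Implicit Types (w A B C D L R T W X Y Z : seq nat).

(** No letter of [B] can pop the last letter of [X], and the first letter of [Z] pops all of [B]
    before it is pushed, so [B] is sorted on its own. Whatever leaves earlier comes from [X]. *)
Lemma stack_sort_factor X B Z : uniq (X ++ B ++ Z) ->
  (X == [::]) || all (gtn (last 0 X)) B -> (Z == [::]) || all (gtn (head 0 Z)) B ->
  exists P Q, stack_sort (X ++ B ++ Z) = P ++ stack_sort B ++ Q /\ {subset P <= X}.
Proof.
elim: {X Z}_.+1 {-2}X {-2}Z (ltnSn (size (X ++ Z))) => // k IH X Z sz uw hX hZ.
have [/andP[/eqP X0 /eqP Z0]|XZN0] := boolP ((X == [::]) && (Z == [::])).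
  by exists [::], [::]; rewrite X0 Z0 /= !cats0.
have wN0 : X ++ B ++ Z != [::].
  by apply: contra XZN0; rewrite -!nilpE /nilp !size_cat !addn_eq0 => /and3P[-> _ ->].
have [L [m [S [wE hL hS]]]] := uniq_max_split uw wN0.
have lem x : x \in X ++ B ++ Z -> x <= m.
  by rewrite wE mem_cat inE => /or3P[/(allP hL)/ltnW|/eqP->|/(allP hS)/ltnW].
have mB : m \notin B.
  apply/negP => mB; case/nandP: XZN0 => N0.
    rewrite (negPf N0) /= in hX; have := allP hX _ mB => /=; rewrite ltnNge => /negP; apply.
    by apply: lem; rewrite mem_cat; case: (X) N0 => //= x X' _; rewrite mem_last.
  rewrite (negPf N0) /= in hZ; have := allP hZ _ mB => /=; rewrite ltnNge => /negP; apply.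
  by apply: lem; rewrite !mem_cat; case: (Z) N0 => //= z Z' _; rewrite inE eqxx !orbT.
have : m \in X ++ B ++ Z by rewrite wE mem_cat inE eqxx orbT.
rewrite !mem_cat (negPf mB) /= => /orP[mX|mZ].
  have [X1 [X2 XE]] : exists X1 X2, X = X1 ++ m :: X2.
    by case/splitPr: mX => X1 X2; exists X1, X2.
  move: uw wE lem sz hX; rewrite XE -!catA !cat_cons => uw wE lem sz hX.
  have nm : m \notin X1 ++ X2 ++ B ++ Z.
    move: uw; rewrite -cat_cons uniq_catCA cat_cons cons_uniq -uniq_catCA => /andP[].
    by rewrite !mem_cat orbCA.
  have ltm x : x \in X1 ++ X2 ++ B ++ Z -> x < m.
    move=> xI; rewrite ltn_neqAle lem ?andbT.
      by apply: contraNneq nm => <-.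
    by move: xI; rewrite mem_cat [in X in _ -> X]mem_cat inE => /orP[]->; rewrite ?orbT.
  have [||||P [Q [PQ PX]]] := IH X2 Z.
  - by move: sz; rewrite !size_cat /= ?size_cat; clear; lia.
  - by move: uw; rewrite cat_uniq => /and3P[_ _ /andP[]].
  - move: hX; case: (X2) => //= x X3; rewrite last_cat /=.
    by move=> /orP[|->]; rewrite ?orbT //; case: (X1).
  - exact: hZ.
  exists (stack_sort X1 ++ P), (Q ++ [:: m]).
  rewrite stack_sort_split; first 1 last.
  - by apply/allP => x xI; apply: ltm; rewrite mem_cat xI.
  - by apply/allP => x xI; apply: ltm; rewrite mem_cat xI orbT.
  rewrite PQ -!catA; split=> // x; rewrite !mem_cat inE => /orP[|/PX->]; rewrite ?orbT //.
  by rewrite mem_stack_sort; [move=> ->|move: uw; rewrite cat_uniq => /and3P[]].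
have [Z1 [Z2 ZE]] : exists Z1 Z2, Z = Z1 ++ m :: Z2.
  by case/splitPr: mZ => Z1 Z2; exists Z1, Z2.
have E : X ++ B ++ Z = (X ++ B ++ Z1) ++ m :: Z2 by rewrite ZE -!catA.
rewrite E in uw wE lem *.
have nm : m \notin (X ++ B ++ Z1) ++ Z2.
  by move: uw; rewrite uniq_catC cat_cons cons_uniq => /andP[]; rewrite !mem_cat orbC.
have ltm x : x \in (X ++ B ++ Z1) ++ Z2 -> x < m.
  move=> xI; rewrite ltn_neqAle lem ?andbT.
    by apply: contraNneq nm => <-.
  by move: xI; rewrite mem_cat [in X in _ -> X]mem_cat inE => /orP[]->; rewrite ?orbT.
have [||||P [Q [PQ PX]]] := IH X Z1.
- by move: sz; rewrite ZE !size_cat /= ?size_cat; clear; lia.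
- by move: uw; rewrite cat_uniq => /and3P[].
- exact: hX.
- by move: hZ; rewrite ZE; case: (Z1).
exists P, (Q ++ stack_sort Z2 ++ [:: m]); rewrite stack_sort_split; first 1 last.
- by apply/allP => x xI; apply: ltm; rewrite mem_cat xI.
- by apply/allP => x xI; apply: ltm; rewrite mem_cat xI orbT.
by rewrite PQ -!catA.
Qed.

(** Extends a block ending in [m] as far to the left as the letters stay below [m], so that
    [stack_sort_factor] applies. *)
Lemma split_suffix_lt X m : exists X1 X2,
  [/\ X = X1 ++ X2, all (gtn m) X2 & (X1 == [::]) || (m <= last 0 X1)].
Proof.
elim/last_ind: X => [|X x [X1 [X2 [-> h2 h1]]]]; first by exists [::], [::].
have [xm|mx] := ltnP x m.
  by exists X1, (rcons X2 x); rewrite rcons_cat all_rcons /= xm h2.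
by exists (rcons (X1 ++ X2) x), [::]; rewrite cats0 last_rcons mx orbT.
Qed.

(* In one step at most one letter of the factor [B m] passes [a]: its largest one. *)
Lemma count_factor_le_steps t X B m Y a : uniq (X ++ rcons B m ++ Y) ->
  all (gtn m) B -> a \in Y -> sorted ltn (iter t stack_sort (X ++ rcons B m ++ Y)) ->
  count (ltn a) (rcons B m) <= t.
Proof.
elim: t X B m Y => [|t IH] X B m Y uw Bm aY sw.
  rewrite leqn0 -leqn0 leqNgt -has_count -all_predC; apply/allP => x xB /=.
  move: sw; rewrite /= (sorted_pairwise ltn_trans) !pairwise_cat => /and5P[_ _ +  _ _].
  by move/allrelP => /(_ _ _ xB aY) /= xa; rewrite -leqNgt ltnW.
(* The letter [m] flushes the run [X2 B] before it, whose image is again a factor ending with its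
   maximum. Only [m] drops out of the count, and [a] still lies to the right. *)
have [X1 [X2 [XE X2m X1m]]] := split_suffix_lt X m.
have leB : count (ltn a) (rcons B m) <= count (ltn a) (X2 ++ B) + 1.
  by rewrite -cats1 !count_cat /= addn0 leq_add ?leq_addl // leq_b1.
apply: (leq_trans leB); rewrite addn1 ltnS.
have E : X ++ rcons B m ++ Y = X1 ++ (X2 ++ B) ++ (m :: Y).
  by rewrite XE cat_rcons -!catA.
rewrite E in uw sw.
have all2 : all (gtn m) (X2 ++ B) by rewrite all_cat X2m.
have [|||P [Q [PQ PX]]] := @stack_sort_factor X1 (X2 ++ B) (m :: Y).
- exact: uw.
- by case/orP: X1m => [->//|h]; apply/orP; right; apply: all_gtn_trans all2.
- exact: all2.
have uB : uniq (X2 ++ B) by move: uw; rewrite cat_uniq (cat_uniq (X2 ++ B)) => /and5P[].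
have [->//|BN0] := eqVneq (X2 ++ B) [::].
have [B' [b [BE B'b _]]] := stack_sort_last_max uB BN0.
rewrite -(count_stack_sort _ uB) BE; apply: (IH P B' b Q) => //.
- by rewrite -BE -PQ uniq_stack_sort.
- have : a \in P ++ rcons B' b ++ Q.
    by rewrite -BE -PQ mem_stack_sort // !mem_cat inE aY !orbT.
  have nX : a \notin X1.
    apply/negP => aX; move: uw; rewrite cat_uniq => /and3P[_ /hasPn/(_ a) + _].
    by rewrite /= aX mem_cat inE aY !orbT => /(_ isT).
  have nB : a \notin rcons B' b.
    rewrite -BE mem_stack_sort //; apply/negP => aB.
    move: uw; rewrite cat_uniq (cat_uniq (X2 ++ B)) => /and5P[_ _ _ /hasPn/(_ a) + _].
    by rewrite /= aB inE aY orbT => /(_ isT).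
  by rewrite !mem_cat (negPf nB) => /orP[/PX aX|//]; rewrite aX in nX.
- by rewrite -BE -PQ -iterSr.
Qed.

(* [gap 0 w] is the largest distance between consecutive right-to-left maxima of
   [w]; [c] counts the letters read since the last one. *)
Fixpoint gap (c : nat) w : nat :=
  if w is x :: w' then
    if all (gtn x) w' then maxn c.+1 (gap 0 w') else gap c.+1 w'
  else 0.

(** A largest gap is realised by a block [B m] ending at a right-to-left maximum. The [c] letters
    read before [w] can lengthen it only if it starts the word. *)
Lemma gap_factor c w : uniq w -> w != [::] -> exists X B m Y,
  [/\ w = X ++ rcons B m ++ Y, all (gtn m) B, all (gtn m) Y
    & gap c w <= (size B).+1 + (if X == [::] then c else 0)].
Proof.
elim: w c => // x w IH c; rewrite cons_uniq => /andP[xw uw] _.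
rewrite [gap _ _]/=; case: ifPn => hx.
  have [le|lt] := leqP (gap 0 w) c.+1.
    by exists [::], [::], x, w; split=> //.
  have wN0 : w != [::] by case: (w) lt.
  have [X [B [m [Y [wE Bm Ym le]]]]] := IH 0 uw wN0.
  exists (x :: X), B, m, Y; rewrite wE in lt le *; split => //.
  by rewrite if_same addn0 in le; rewrite addn0.
have wN0 : w != [::] by apply: contraNneq hx => ->.
have [X [B [m [Y [wE Bm Ym le]]]]] := IH c.+1 uw wN0.
case: X wE le => [|z X] wE le.
  exists [::], (x :: B), m, Y; split => //; first by rewrite wE.
    rewrite /= Bm andbT.
    have /allPn[y yw] := hx; rewrite /= -leqNgt => xy.
    have ym : y <= m.
      move: yw; rewrite wE /= mem_cat mem_rcons inE -orbA.
      by move=> /or3P[/eqP->//|/(allP Bm)/ltnW|/(allP Ym)/ltnW].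
    rewrite ltn_neqAle (leq_trans xy ym) andbT; apply: contraNneq xw => ->.
    by rewrite wE /= mem_cat mem_rcons inE eqxx.
  by move: le; rewrite /= addnS.
by exists (x :: z :: X), B, m, Y; split=> //; rewrite wE.
Qed.

(** With [a] the minimum of [v], at most [t] letters of the longest block exceed [a] by
    [count_factor_le_steps]; its other letters lie below all of [v]. *)
Lemma gap_le_steps t (w v : seq nat) : uniq (w ++ v) -> v != [::] ->
  sorted ltn (iter t stack_sort (w ++ v)) ->
  gap 0 w <= t + count (fun x => all (ltn x) v) w.
Proof.
move=> uw vN0 sw; have [->//|wN0] := eqVneq w [::].
have [a av mina] : exists2 a, a \in v & all (leq a) v.
  elim: v vN0 {uw sw} => // x v IH _.
  have [->|vN0] := eqVneq v [::]; first by exists x; rewrite ?inE //= leqnn.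
  have [a av mina] := IH vN0.
  have [xa|ax] := leqP x a.
    by exists x; rewrite ?inE ?eqxx //= leqnn; apply: sub_all mina => y; apply: leq_trans.
  by exists a; rewrite ?inE ?av ?orbT //= (ltnW ax).
have uw1 : uniq w by move: uw; rewrite cat_uniq => /and3P[].
have [X [B [m [Y [wE Bm Ym le]]]]] := gap_factor 0 uw1 wN0.
rewrite if_same addn0 in le; apply: (leq_trans le).
have E : w ++ v = X ++ rcons B m ++ (Y ++ v) by rewrite wE -!catA.
have ct : count (ltn a) (rcons B m) <= t.
  apply: (@count_factor_le_steps t X B m (Y ++ v)); rewrite -?E //.
  by rewrite mem_cat av orbT.
have aB : a \notin rcons B m.
  apply/negP => aB; move: uw; rewrite cat_uniq => /and3P[_ /hasPn/(_ _ av) + _].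
  by rewrite /= wE !mem_cat aB orbT.
rewrite -(size_rcons B m) -(count_predC (ltn a)) leq_add //.
rewrite wE !count_cat; apply: (leq_trans _ (leq_addl _ _)); apply: (leq_trans _ (leq_addr _ _)).
rewrite -!size_filter; apply: uniq_leq_size.
  by apply: filter_uniq; move: uw1; rewrite wE cat_uniq (cat_uniq (rcons B m)) => /and5P[].
move=> x; rewrite !mem_filter => /andP[/= xa xB]; rewrite xB andbT.
have ltx : x < a.
  by rewrite ltn_neqAle leqNgt xa andbT; apply: contraNneq aB => <-.
by apply: sub_all mina => y; apply: leq_trans.
Qed.

End LowerWords.

(** * Permutations as words, and insertion of one letter *)

Section PermWords.
Local Open Scope nat_scope.
Local Open Scope seq_scope.

(** Zero-based, so that letters are ordinals and [lift_perm] acts on them directly. *)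
Definition word n (p : 'S_n) : seq nat := [seq (p i : nat) | i <- enum 'I_n].

Lemma one_lineE n (p : 'S_n) : one_line p = [seq x.+1 | x <- word p].
Proof. by rewrite /one_line /word -map_comp. Qed.

Lemma size_word n (p : 'S_n) : size (word p) = n.
Proof. by rewrite size_map size_enum_ord. Qed.

Lemma nth_word n (p : 'S_n) (i : 'I_n) : nth 0 (word p) i = p i.
Proof. by rewrite (nth_map i) ?size_enum_ord // nth_ord_enum. Qed.

Lemma mem_word n (p : 'S_n) x : (x \in word p) = (x < n).
Proof.
apply/mapP/idP => [[i _ ->]|xn]; first exact: ltn_ord.
by exists (p^-1%g (Ordinal xn)); rewrite ?mem_enum // permKV.
Qed.

(** Reads [lift_perm] as the insertion of the value [j] at position [i]; [bump j] makes room for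
    it. *)
Lemma word_lift_perm n (i j : 'I_n.+1) (s : 'S_n) :
  word (lift_perm i j s) = take i [seq bump j x | x <- word s] ++
    (j : nat) :: drop i [seq bump j x | x <- word s].
Proof.
have szt : size (take i [seq bump j x | x <- word s]) = i.
  by rewrite size_take size_map size_word; case: ltnP => // ni; have := ltn_ord i; lia.
apply: (@eq_from_nth _ 0).
  rewrite size_word size_cat szt /= size_drop size_map size_word.
  by have := ltn_ord i; lia.
move=> k; rewrite size_word => ltk; rewrite -[k]/(val (Ordinal ltk)) nth_word.
case: (unliftP i (Ordinal ltk)) => [l -> | ->].
  rewrite lift_perm_lift nth_cat szt /= /bump.
  case: (leqP i l) => io; last first.
    by rewrite add0n io nth_take // (nth_map 0) ?size_word // nth_word.
  rewrite add1n ltnNge leqW //= subSn //= nth_drop subnKC //.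
  by rewrite (nth_map 0) ?size_word // nth_word.
by rewrite lift_perm_id nth_cat szt ltnn subnn.
Qed.

Section Sums.
Context {V : nmodType} (n : nat) (F : 'S_n.+1 -> V).

Lemma card_ord_perm : #|{: 'I_n.+1 * 'S_n}| = #|{: 'S_n.+1}|.
Proof. by rewrite card_prod !card_Sn card_ord factS. Qed.

(** Conditions on the value at position [i]: insertion is injective between sets of equal size. *)
Lemma big_lift_perm_l (i : 'I_n.+1) :
  (\sum_p F p = \sum_j \sum_s F (lift_perm i j s))%R.
Proof.
have inj : injective (fun js : 'I_n.+1 * 'S_n => lift_perm i js.1 js.2).
  move=> [j s] [j' s'] /= E.
  have jj : j = j' by have := congr1 (fun p : 'S_n.+1 => p i) E; rewrite !lift_perm_id.
  rewrite -jj in E *; congr pair; apply/permP => k.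
  by have := congr1 (fun p : 'S_n.+1 => p (lift i k)) E; rewrite !lift_perm_lift => /lift_inj.
rewrite (reindex (fun js : 'I_n.+1 * 'S_n => lift_perm i js.1 js.2)) /=.
  by rewrite pair_big.
by apply: onW_bij; apply: inj_card_bij => //; rewrite card_ord_perm.
Qed.

(** Conditions on the position of the value [j], which the inverse permutation recovers. *)
Lemma big_lift_perm_r (j : 'I_n.+1) :
  (\sum_p F p = \sum_i \sum_s F (lift_perm i j s))%R.
Proof.
have inj : injective (fun js : 'I_n.+1 * 'S_n => lift_perm js.1 j js.2).
  move=> [i s] [i' s'] /= E.
  have jj : i = i'.
    have := congr1 (fun p : 'S_n.+1 => p^-1%g j) E.
    by rewrite !lift_permV !lift_perm_id.
  rewrite -jj in E *; congr pair; apply/permP => k.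
  by have := congr1 (fun p : 'S_n.+1 => p (lift i k)) E; rewrite !lift_perm_lift => /lift_inj.
rewrite (reindex (fun js : 'I_n.+1 * 'S_n => lift_perm js.1 j js.2)) /=.
  by rewrite pair_big.
by apply: onW_bij; apply: inj_card_bij => //; rewrite card_ord_perm.
Qed.

End Sums.

Definition order_invariant (f : seq nat -> nat) :=
  forall g w, {mono g : x y / x <= y} -> f [seq g x | x <- w] = f w.

Lemma bump_mono j : {mono bump j : x y / x <= y}.
Proof. by move=> x y; rewrite leq_bump2. Qed.

(** The first [n] letters are in uniformly random relative order: inserting a last letter only
    relabels the prefix. The factorials are cross-multiplied to stay in [nat]. *)
Lemma sum_word_take k n f : order_invariant f ->
  n`! * \sum_(p : 'S_(k + n)) f (take n (word p)) = (k + n)`! * \sum_(p : 'S_n) f (word p).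
Proof.
move=> inv; elim: k => [|k IH].
  by congr (_ * _); apply: eq_bigr => p _; rewrite take_oversize // size_word.
rewrite (big_lift_perm_l _ (@ord_max (k + n))).
rewrite (eq_bigr (fun=> \sum_(p : 'S_(k + n)) f (take n (word p)))); last first.
  move=> j _; apply: eq_bigr => s _; rewrite word_lift_perm.
  have szu : size [seq bump j x | x <- word s] = k + n by rewrite size_map size_word.
  rewrite [take (@ord_max (k + n)) _]take_oversize ?szu // takel_cat ?szu ?leq_addl //.
  by rewrite -map_take inv //; exact: bump_mono.
by rewrite sum_nat_const card_ord mulnCA IH mulnA factS.
Qed.

Lemma sum_word_drop k n f : order_invariant f ->
  n`! * \sum_(p : 'S_(k + n)) f (drop k (word p)) = (k + n)`! * \sum_(p : 'S_n) f (word p).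
Proof.
move=> inv; elim: k => [|k IH].
  by congr (_ * _); apply: eq_bigr => p _; rewrite drop0.
rewrite (big_lift_perm_l _ (@ord0 (k + n))).
rewrite (eq_bigr (fun=> \sum_(p : 'S_(k + n)) f (drop k (word p)))); last first.
  move=> j _; apply: eq_bigr => s _; rewrite word_lift_perm take0 drop0 /= -map_drop inv //.
  exact: bump_mono.
by rewrite sum_nat_const card_ord mulnCA IH mulnA factS.
Qed.

Lemma mono_ltn (g : nat -> nat) : {mono g : x y / x <= y} -> {mono g : x y / x < y}.
Proof. by move=> gm x y; rewrite !ltnNge gm. Qed.

Lemma gap_map c (g : nat -> nat) w : {mono g : x y / x <= y} ->
  gap c [seq g x | x <- w] = gap c w.
Proof.
move=> gm; elim: w c => //= x w IH c.
have -> : all (gtn (g x)) [seq g x | x <- w] = all (gtn x) w.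
  by rewrite all_map; apply: eq_all => y /=; rewrite mono_ltn.
by rewrite !IH.
Qed.

Lemma gap_invariant c : order_invariant (gap c).
Proof. by move=> g w gm; exact: gap_map. Qed.

(** Raising a threshold to the next letter of [R] keeps the count in [R] and cannot increase the one
    in [L]. Thresholds that are letters can be carried along a relabelling [g], whose image may miss
    other integers. *)
Lemma ballotP L R :
  ballot L R <-> {in R, forall y, count (leq y) R <= (count (leq y) L).+1}.
Proof.
split=> [h y _|h v]; first exact: h.
have [/eqP|nz] := eqVneq (count (leq v) R) 0; first by move=> /eqP ->.
have hasv : has (leq v) R by rewrite has_count lt0n.
have ex : exists y, (y \in R) && (v <= y) by move/hasP: hasv => [y ? ?]; exists y; apply/andP.
case: (ex_minnP ex) => y /andP[yR vy] miny.
have -> : count (leq v) R = count (leq y) R.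
  apply: eq_in_count => z zR; apply/idP/idP; last exact: leq_trans.
  by move=> vz; apply: miny; rewrite zR.
apply: (leq_trans (h _ yR)); rewrite ltnS; apply: sub_count => z /=; exact: leq_trans.
Qed.

Lemma ballot_map (g : nat -> nat) L R : {mono g : x y / x <= y} ->
  ballot [seq g x | x <- L] [seq g x | x <- R] <-> ballot L R.
Proof.
move=> gm.
have ct v w : count (leq (g v)) [seq g x | x <- w] = count (leq v) w.
  by rewrite count_map; apply: eq_count => y /=; rewrite gm.
rewrite !ballotP; split=> h y.
  by move=> yR; have := h (g y); rewrite !ct; apply; exact: map_f.
by move/mapP=> [z zR ->]; rewrite !ct; exact: h.
Qed.

Lemma merge_bound_map acc (g : nat -> nat) w : {mono g : x y / x <= y} ->
  merge_bound [seq g x | x <- acc] [seq g x | x <- w] = merge_bound acc w.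
Proof.
move=> gm; elim: w acc => //= x w IH acc.
have -> : all (gtn (g x)) [seq g x | x <- w] = all (gtn x) w.
  by rewrite all_map; apply: eq_all => y /=; rewrite mono_ltn.
have -> : `[< ballot [seq g x | x <- acc] [seq g x | x <- w] >] = `[< ballot acc w >].
  by apply: asbool_equiv_eq; exact: ballot_map.
by rewrite -[[::]]/[seq g x | x <- [::]] IH -map_rcons IH size_map.
Qed.

Lemma merge_bound_invariant : order_invariant (merge_bound [::]).
Proof. by move=> g w gm; rewrite -[[::]]/[seq g x | x <- [::]] merge_bound_map. Qed.

End PermWords.

(** * A common recursion for cycles and for blocks *)

Section CyclesAndGaps.
Local Open Scope nat_scope.
Local Open Scope seq_scope.

Section Porbit.
Variable T : finType.
Implicit Types (p q : {perm T}) (x y : T).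

Lemma porbit_closed p x y : y \in porbit p x -> p y \in porbit p x.
Proof.
move=> /porbitP[i ->]; apply/porbitP; exists i.+1.
by rewrite -permM expgSr.
Qed.

Lemma porbit_subset p x (C : {set T}) : x \in C ->
  (forall y, y \in C -> p y \in C) -> porbit p x \subset C.
Proof.
move=> xC pC; apply/fintype.subsetP => y /porbitP[i ->].
by elim: i => [|i IH]; rewrite ?expg0 ?perm1 // expgSr permM pC.
Qed.

(** The permutation [p] differs from [q] only in sending [j] to [x0] and [x0] to [q j]. *)
Lemma porbit_insert p q x0 j : q x0 = x0 -> p = (tperm x0 j * q)%g ->
  porbit p x0 = x0 |: porbit q j /\
  (forall y, y \notin x0 |: porbit q j -> porbit p y = porbit q y).
Proof.
move=> qx0 pE; set C := x0 |: _.
have px0 : p x0 = q j by rewrite pE permM tpermL.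
have pj : p j = x0 by rewrite pE permM tpermR.
have pq y : y != x0 -> y != j -> p y = q y.
  by move=> y0 yj; rewrite pE permM tpermD // eq_sym.
have jq : j \in porbit q j by exact: porbit_id.
have CC y : y \in C -> p y \in C.
  rewrite !inE; have [->|y0] := eqVneq y x0; first by rewrite px0 porbit_closed ?orbT.
  have [->|yj] := eqVneq y j; first by rewrite pj eqxx.
  by rewrite pq //= => yC; rewrite porbit_closed ?orbT.
split.
  apply/eqP; rewrite finset.eqEsubset porbit_subset ?inE ?eqxx //=.
  rewrite finset.subUset finset.sub1set porbit_id /=; apply: porbit_subset.
    by rewrite porbit_sym -{1}pj porbit_closed // porbit_id.
  move=> y yP; have [->|y0] := eqVneq y x0; first by rewrite qx0 porbit_id.
  have [->|yj] := eqVneq y j; first by rewrite -px0 porbit_closed // porbit_id.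
  by rewrite -pq // porbit_closed.
move=> y yC.
have ny z : z \in porbit q y -> (z != x0) && (z != j).
  move=> zq; have yz : porbit q y = porbit q z by apply/eqP; rewrite eq_porbit_mem porbit_sym.
  apply/andP; split; apply: contraNneq yC => zE; last first.
    by rewrite !inE -zE -yz porbit_id orbT.
  have : y \in porbit q x0 by rewrite -zE -yz porbit_id.
  have /fintype.subsetP sub : porbit q x0 \subset [set x0].
    by apply: porbit_subset; rewrite ?inE // => w; rewrite inE => /eqP ->; rewrite qx0 inE.
  by move/sub; rewrite !inE => ->.
have sub1 : porbit p y \subset porbit q y.
  apply: porbit_subset; first exact: porbit_id.
  by move=> z zq; have /andP[z0 zj] := ny _ zq; rewrite pq // porbit_closed.
apply/eqP; rewrite finset.eqEsubset sub1 /=; apply: porbit_subset; first exact: porbit_id.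
move=> z zp; have /andP[z0 zj] := ny _ (fintype.subsetP sub1 _ zp).
by rewrite -pq // porbit_closed.
Qed.

End Porbit.

Lemma porbit_image (T T' : finType) (s : {perm T}) (q : {perm T'}) (g : T -> T') y :
  (forall z, g (s z) = q (g z)) -> porbit q (g y) = g @: porbit s y.
Proof.
move=> gs; apply/eqP; rewrite finset.eqEsubset; apply/andP; split.
  apply: porbit_subset; first by rewrite imset_f // porbit_id.
  by move=> _ /imsetP[z zs ->]; rewrite -gs imset_f // porbit_closed.
apply/fintype.subsetP => _ /imsetP[z zs ->].
have /fintype.subsetP/(_ z zs) : porbit s y \subset g @^-1: porbit q (g y).
  apply: porbit_subset; first by rewrite inE porbit_id.
  by move=> w; rewrite !inE gs => /porbit_closed.
by rewrite inE.
Qed.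

Definition short_cycles m n (p : 'S_n) : bool := [forall y, #|porbit p y| <= m].

Lemma longest_cycle_leq m n (p : 'S_n) : (longest_cycle p <= m) = short_cycles m p.
Proof.
apply/bigmax_leqP/forallP => h.
  by move=> y; apply: h; exact: imset_f.
by move=> _ /imsetP[y _ ->]; exact: h.
Qed.

(** Here [c] stands for letters already deleted from the cycle of [ord_max], just as the first
    argument of [gap] counts the letters of the open block. *)
Definition short_count m n c : nat :=
  \sum_(p : 'S_n.+1) (short_cycles m p && (#|porbit p ord_max| + c <= m)).

(** Conjugation by the transposition of [k] and [ord_max] preserves cycle lengths. *)
Lemma sum_short_at m n c (k : 'I_n.+1) :
  \sum_(p : 'S_n.+1) (short_cycles m p && (#|porbit p k| + c <= m) : nat) = short_count m n c.
Proof.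
pose g := tperm k ord_max.
rewrite (reindex_inj (@conjg_inj _ g)) /short_count.
apply: eq_bigr => p _; congr nat_of_bool.
have card y : #|porbit (p ^ g)%g (g y)| = #|porbit p y|.
  rewrite (@porbit_image _ _ p (p ^ g)%g g) ?card_imset //; first exact: perm_inj.
  by move=> z; rewrite permJ.
congr andb; last by rewrite -[k](tpermR k ord_max) card.
apply/forallP/forallP => h y; first by rewrite -card.
by rewrite -[y](tpermK k ord_max) card.
Qed.

(* Inserts the new letter [ord_max] just after [j] in the cycle of [j]. *)
Definition grow n (j : 'I_n.+1) (s : 'S_n) : 'S_n.+1 :=
  (tperm ord_max j * lift_perm ord_max ord_max s)%g.

Lemma big_grow (V : nmodType) n (F : 'S_n.+1 -> V) :
  (\sum_p F p = \sum_j \sum_s F (grow j s))%R.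
Proof.
have inj : injective (fun js : 'I_n.+1 * 'S_n => grow js.1 js.2).
  move=> [j s] [j' s'] /= E.
  have growV (k : 'I_n.+1) (u : 'S_n) : (grow k u)^-1%g ord_max = k.
    by apply: (@perm_inj _ (grow k u)); rewrite permKV /grow permM tpermR lift_perm_id.
  have jj : j = j' by rewrite -(growV j s) E growV.
  rewrite -jj in E *; congr pair; apply/permP => k.
  move/mulgI: E => E.
  by have := congr1 (fun p : 'S_n.+1 => p (lift ord_max k)) E; rewrite !lift_perm_lift => /lift_inj.
rewrite (reindex (fun js : 'I_n.+1 * 'S_n => grow js.1 js.2)) /=.
  by rewrite pair_big.
by apply: onW_bij; apply: inj_card_bij => //; rewrite card_ord_perm.
Qed.

Lemma porbit_lift n (s : 'S_n) (y : 'I_n) :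
  porbit (lift_perm ord_max ord_max s) (lift ord_max y) = lift ord_max @: porbit s y.
Proof. by apply: porbit_image => z; rewrite lift_perm_lift. Qed.

Lemma card_porbit_lift n (s : 'S_n) (y : 'I_n) :
  #|porbit (lift_perm ord_max ord_max s) (lift ord_max y)| = #|porbit s y|.
Proof. by rewrite porbit_lift card_imset //; exact: lift_inj. Qed.

Lemma short_grow_max m n c (s : 'S_n) :
  short_cycles m (grow ord_max s) && (#|porbit (grow ord_max s) ord_max| + c <= m) =
  (c < m) && short_cycles m s.
Proof.
rewrite /grow tperm1 mul1g; set q := lift_perm _ _ s.
have -> : porbit q ord_max = [set ord_max].
  apply/eqP; rewrite finset.eqEsubset finset.sub1set porbit_id andbT.
  by apply: porbit_subset; rewrite ?inE // => w; rewrite inE => /eqP ->; rewrite lift_perm_id inE.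
rewrite cards1 add1n andbC; apply: andb_id2l => cm.
apply/forallP/forallP => h y; first by rewrite -card_porbit_lift.
case: (unliftP ord_max y) => [k -> | ->]; first by rewrite card_porbit_lift.
have -> : porbit q ord_max = [set ord_max].
  apply/eqP; rewrite finset.eqEsubset finset.sub1set porbit_id andbT.
  by apply: porbit_subset; rewrite ?inE // => w; rewrite inE => /eqP ->; rewrite lift_perm_id inE.
by rewrite cards1; apply: leq_trans cm.
Qed.

Lemma short_grow_lift m n c (k : 'I_n) (s : 'S_n) :
  short_cycles m (grow (lift ord_max k) s) &&
    (#|porbit (grow (lift ord_max k) s) ord_max| + c <= m) =
  short_cycles m s && (#|porbit s k| + c.+1 <= m).
Proof.
set p := grow _ s; set q := lift_perm ord_max ord_max s.
have [p0 pN] := @porbit_insert _ p q ord_max (lift ord_max k) (lift_perm_id _ _ _) erefl.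
have c0 : #|porbit p ord_max| = (#|porbit s k|).+1.
  rewrite p0 cardsU1 card_porbit_lift porbit_lift.
  suff -> : ord_max \notin lift ord_max @: porbit s k by [].
  apply/negP => /imsetP[z _ E]; have := neq_lift ord_max z.
  by rewrite -E eqxx.
rewrite c0 addSnnS andbC [RHS]andbC; apply: andb_id2l => le.
apply/forallP/forallP => h y.
  have [yC|yC] := boolP (lift ord_max y \in ord_max |: porbit q (lift ord_max k)).
    have yp : lift ord_max y \in porbit p ord_max by rewrite p0.
    move: yC; rewrite !inE eq_sym (negPf (neq_lift _ _)) /= => yk.
    have -> : #|porbit s y| = #|porbit s k|.
      rewrite -(card_porbit_lift s y) -(card_porbit_lift s k) -/q.
      suff -> : porbit q (lift ord_max y) = porbit q (lift ord_max k) by [].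
      by apply/eqP; rewrite eq_porbit_mem.
    by apply: leq_trans le; rewrite leq_addr.
  by rewrite -card_porbit_lift -/q -pN.
have [yC|yC] := boolP (y \in ord_max |: porbit q (lift ord_max k)).
  have -> : porbit p y = porbit p ord_max by apply/eqP; rewrite eq_porbit_mem p0.
  by rewrite c0; apply: leq_trans le; rewrite addnS ltnS leq_addr.
rewrite pN //; case: (unliftP ord_max y) yC => [l -> _ | ->]; first by rewrite card_porbit_lift.
by rewrite !inE eqxx.
Qed.

(** Delete [ord_max]. If it is fixed, it closes a cycle of length [c + 1]; otherwise it follows one
    of [n] letters, whose cycle inherits the count [c + 1]. *)
Lemma short_countS m n c : short_count m n c =
  (c < m) * \sum_(p : 'S_n) short_cycles m p +
  (if n is n'.+1 then n * short_count m n' c.+1 else 0).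
Proof.
rewrite /short_count big_grow big_ord_recr /= addrC.
congr (_ + _)%N.
  rewrite big_distrr /=; apply: eq_bigr => s _; rewrite short_grow_max.
  by case: (c < m); rewrite ?mul1n ?mul0n.
case: n => [|n]; first by rewrite big_ord0.
rewrite (eq_bigr (fun=> short_count m n c.+1)); first by rewrite sum_nat_const card_ord.
move=> k _; rewrite -(sum_short_at m c.+1 k); apply: eq_bigr => s _.
have -> : widen_ord (leqnSn n.+1) k = lift ord_max k.
  by apply: val_inj; rewrite /= /bump leqNgt ltn_ord.
by rewrite short_grow_lift.
Qed.

Definition gap_count m n c : nat := \sum_(p : 'S_n) (gap c (word p) <= m).

(** Delete the first letter. If it is the maximum, it closes a block of length [c + 1]; each of the
    [n] other values leaves the block open. This mirrors [short_countS]. *)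
Lemma gap_countS m n c : gap_count m n.+1 c =
  (c < m) * gap_count m n 0 + n * gap_count m n c.+1.
Proof.
rewrite /gap_count (big_lift_perm_l _ ord0) big_ord_recr /= addrC; congr (_ + _)%N.
  rewrite big_distrr /=; apply: eq_bigr => s _.
  rewrite word_lift_perm take0 drop0 /=.
  have -> : all (gtn n) [seq bump n x | x <- word s].
    rewrite all_map; apply/allP => x; rewrite mem_word /= => xn.
    by rewrite /bump [n <= x]leqNgt xn.
  rewrite geq_max gap_map; last exact: bump_mono.
  by case: (c < m); rewrite ?mul1n ?mul0n.
rewrite (eq_bigr (fun=> gap_count m n c.+1)); first by rewrite sum_nat_const card_ord.
move=> j _; apply: eq_bigr => s _; rewrite word_lift_perm take0 drop0 /=.
case: n j s => [[]//|n] j s.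
have -> : all (gtn j) [seq bump j x | x <- word s] = false.
  apply/negbTE/allPn; exists n.+1; last by rewrite /= -leqNgt ltnW.
  apply/mapP; exists n; first by rewrite mem_word.
  by rewrite /bump -ltnS ltn_ord.
by rewrite gap_map //; exact: bump_mono.
Qed.

End CyclesAndGaps.

(** * Equal means of the longest cycle and the longest block *)

Section Counting.
Local Open Scope nat_scope.
Local Open Scope seq_scope.

(** Both sides obey the same recursion. The index shifts because [short_count m n] sums over
    ['S_n.+1]; at [c = 0] its second condition follows from the first. *)
Lemma short_count_gap m n :
  \sum_(p : 'S_n) short_cycles m p = gap_count m n 0 /\
  forall c, short_count m n c = gap_count m n.+1 c.
Proof.
elim: n => [|n [IH1 IH2]].
  have E : \sum_(p : 'S_0) short_cycles m p = gap_count m 0 0.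
    apply: eq_bigr => p _; rewrite (size0nil (size_word p)) /=.
    by have -> : short_cycles m p by apply/forallP => -[].
  by split=> // c; rewrite short_countS gap_countS E mul0n.
have E : \sum_(p : 'S_n.+1) short_cycles m p = gap_count m n.+1 0.
  rewrite -IH2; apply: eq_bigr => p _; rewrite addn0.
  by case: (boolP (short_cycles m p)) => //= /forallP ->.
by split=> // c; rewrite short_countS gap_countS E IH2.
Qed.

Lemma sum_ltn_ord N k : k <= N -> \sum_(m < N) (m < k) = k.
Proof.
elim: N k => [|N IH] k; first by rewrite leqn0 big_ord0 => /eqP.
rewrite big_ord_recr /= leq_eqVlt => /predU1P[->|kN].
  rewrite ltnSn (eq_bigr (fun=> 1)) ?sum1_card ?card_ord ?addn1 // => i _.
  by rewrite ltnS ltnW.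
by rewrite IH // ltnNge -ltnS kN addn0.
Qed.

(** Each value is the number of levels [m < N] below it, so the sum depends only on the distribution
    function. *)
Lemma eq_sum_of_levels (T : finType) (f g : T -> nat) N :
  (forall x, f x <= N) -> (forall x, g x <= N) ->
  (forall m, \sum_x (f x <= m) = \sum_x (g x <= m)) ->
  \sum_x f x = \sum_x g x.
Proof.
move=> fN gN lev.
have level (h : T -> nat) m : \sum_x (m < h x) = #|T| - \sum_x (h x <= m).
  apply/eqP; rewrite -(eqn_add2r (\sum_x (h x <= m))) -big_split /=.
  rewrite (eq_bigr (fun=> 1)) => [|x _]; last by case: leqP.
  by rewrite sum1_card subnK // -sum1_card leq_sum // => x _; exact: leq_b1.
have main (h : T -> nat) : (forall x, h x <= N) ->
    \sum_x h x = \sum_(m < N) (#|T| - \sum_x (h x <= m)).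
  move=> hN; rewrite (eq_bigr (fun x => \sum_(m < N) (m < h x))).
    by rewrite exchange_big; apply: eq_bigr => m _; exact: level.
  by move=> x _; rewrite sum_ltn_ord.
by rewrite !main //; apply: eq_bigr => m _; rewrite lev.
Qed.

Lemma gap_le_size c w : gap c w <= c + size w.
Proof.
elim: w c => //= x w IH c; case: ifP => _; last by rewrite addnS -addSn.
rewrite geq_max; apply/andP; split; first by rewrite addnS ltnS leq_addr.
by apply: (leq_trans (IH 0)); rewrite addnS add0n leqW // leq_addl.
Qed.

Lemma sum_longest_cycle n :
  \sum_(p : 'S_n) longest_cycle p = \sum_(p : 'S_n) gap 0 (word p).
Proof.
apply: (@eq_sum_of_levels _ _ _ n) => [p|p|m].
- rewrite longest_cycle_leq; apply/forallP => y.
  by rewrite -[leqRHS]card_ord max_card.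
- by apply: (leq_trans (gap_le_size _ _)); rewrite add0n size_word.
- have [E _] := short_count_gap m n.
  rewrite -/(gap_count m n 0) -E.
  by apply: eq_bigr => p _; rewrite longest_cycle_leq.
Qed.

(** * The ballot theorem for a permutation cut in two *)

Definition nonballot N l : nat :=
  \sum_(p : 'S_N) ~~ `[< ballot (take l (word p)) (drop l (word p)) >].

(** Serves to delete the minimal letter 0: the threshold 0 compares total lengths, and positive
    thresholds do not see that letter. *)
Lemma ballot_shift L R L' R' :
  (forall v, count (leq v.+1) L = count (leq v) L') ->
  (forall v, count (leq v.+1) R = count (leq v) R') ->
  ballot L R <-> size R <= (size L).+1 /\ ballot L' R'.
Proof.
move=> eL eR; split=> [h|[sz h] [|v]].
- split; first by have := h 0; rewrite !count_predT.
  by move=> v; rewrite -eL -eR; exact: h.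
- by rewrite !count_predT.
- by rewrite eL eR; exact: h.
Qed.

Lemma count_leqS_map v w : count (leq v.+1) [seq x.+1 | x <- w] = count (leq v) w.
Proof. by rewrite count_map; apply: eq_count => x /=; rewrite ltnS. Qed.

Lemma insert_takel l (u1 u2 : seq nat) x (a : pred nat) : size u1 < l ->
  count a (take l (u1 ++ x :: u2)) = a x + count a (take l.-1 (u1 ++ u2)) /\
  drop l (u1 ++ x :: u2) = drop l.-1 (u1 ++ u2).
Proof.
case: l => // l; rewrite ltnS => le /=.
rewrite !take_cat !drop_cat ltnNge leqW //= [l < size u1]ltnNge le /= subSn //=.
by rewrite !count_cat /= addnCA.
Qed.

Lemma insert_taker l (u1 u2 : seq nat) x (a : pred nat) : l <= size u1 ->
  take l (u1 ++ x :: u2) = take l (u1 ++ u2) /\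
  count a (drop l (u1 ++ x :: u2)) = a x + count a (drop l (u1 ++ u2)).
Proof.
move=> le; rewrite !takel_cat //; split=> //; rewrite !drop_cat.
case: ltnP => [_|ge]; first by rewrite !count_cat /= addnCA.
by have -> : l - size u1 = 0 by [apply/eqP; rewrite subn_eq0]; rewrite !drop0.
Qed.

(** Deleting the minimum moves the cut to [l - 1] when it stood on the left; the inequality of
    lengths is the threshold 0. *)
Lemma ballot_insert_min N l (i : 'I_N.+1) (s : 'S_N) : l <= N.+1 ->
  `[< ballot (take l (word (lift_perm i ord0 s))) (drop l (word (lift_perm i ord0 s))) >] =
  (N.+1 - l <= l.+1) &&
  `[< ballot (take (if i < l then l.-1 else l) (word s))
             (drop (if i < l then l.-1 else l) (word s)) >].
Proof.
move=> lN; set p := lift_perm i ord0 s; set l' := if _ then _ else _.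
have sz1 : size (drop l (word p)) = N.+1 - l by rewrite size_drop size_word.
have sz2 : size (take l (word p)) = l by rewrite size_takel // size_word.
have E : ballot (take l (word p)) (drop l (word p)) <->
   size (drop l (word p)) <= (size (take l (word p))).+1 /\
   ballot (take l' (word s)) (drop l' (word s)).
  have iN : i <= N by rewrite -ltnS ltn_ord.
  set u := [seq x.+1 | x <- word s].
  have szm : size (take i u) = i by rewrite size_takel // size_map size_word.
  have wE : word p = take i u ++ 0 :: drop i u.
    rewrite word_lift_perm; have -> // : [seq bump 0 x | x <- word s] = u.
    by apply: eq_map => x; rewrite /bump leq0n add1n.
  rewrite wE; apply: ballot_shift => v; rewrite /l'; case: ltnP => il.
  - rewrite (@insert_takel l _ _ 0 (leq v.+1) _).1 ?szm //= add0n cat_take_drop.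
    by rewrite -map_take count_leqS_map.
  - rewrite (@insert_taker l _ _ 0 (leq v.+1) _).1 ?szm //= cat_take_drop.
    by rewrite -map_take count_leqS_map.
  - rewrite (@insert_takel l _ _ 0 (leq v.+1) _).2 ?szm //= cat_take_drop.
    by rewrite -map_drop count_leqS_map.
  - rewrite (@insert_taker l _ _ 0 (leq v.+1) _).2 ?szm //= add0n cat_take_drop.
    by rewrite -map_drop count_leqS_map.
rewrite sz1 sz2 in E.
by apply/asboolP/andP => [/E[? /asboolP]|[? /asboolP ?]] //; apply/E.
Qed.

Lemma sum_ord_lt l N (x y : nat) : l <= N ->
  \sum_(i < N) (if i < l then x else y) = l * x + (N - l) * y.
Proof.
move=> lN; rewrite (bigID (fun i : 'I_N => i < l)) /=.
rewrite (eq_bigr (fun=> x)) => [|i ->//].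
rewrite [X in _ + X](eq_bigr (fun=> y)) => [|i /negPf->//].
rewrite !sum_nat_const.
have c1 : #|[pred i : 'I_N | i < l]| = l.
  rewrite -sum1_card (big_ord_narrow lN) sum1_card card_ord //.
congr (_ * _ + _ * _); first exact: c1.
have cC : l + #|predC [pred i : 'I_N | i < l]| = N by rewrite -{1}c1 cardC card_ord.
by rewrite -[X in X - l]cC addKn; apply: fintype.eq_card => i.
Qed.

Lemma nonballotS N l : l <= N.+1 -> nonballot N.+1 l =
  if N.+1 - l <= l.+1 then l * nonballot N l.-1 + (N.+1 - l) * nonballot N l
  else (N.+1)`!.
Proof.
move=> lN; rewrite /nonballot (big_lift_perm_r _ ord0).
case: ifP => sz.
  rewrite -(sum_ord_lt _ _ lN); apply: eq_bigr => i _.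
  case: ifP => il; apply: eq_bigr => s _;
  by rewrite ballot_insert_min // sz il.
rewrite -[RHS]card_Sn -sum1_card (big_lift_perm_r _ ord0).
apply: eq_bigr => i _; apply: eq_bigr => s _.
by rewrite ballot_insert_min // sz.
Qed.

(** With [r = N - l], the failure probability [r (r - 1) / ((l + 1) (l + 2))] solves [nonballotS].
    The range extends to [r = l + 2], where failure is certain, so that the induction may be used at
    [l - 1]. *)
Lemma nonballotE N l : l <= N -> N - l <= l.+2 ->
  nonballot N l * (l.+1 * l.+2) = (N - l) * (N - l).-1 * N`!.
Proof.
elim: N l => [|N IH] l lN sz.
  rewrite sub0n mul0n /nonballot big1 ?mul0n // => p _.
  rewrite (size0nil (size_word p)) /=; case: asboolP => //.
  by case; move=> v.
rewrite nonballotS //; case: ifPn => sz'; last first.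
  have -> : N.+1 - l = l.+2 by apply/eqP; rewrite eqn_leq sz ltnNge.
  by rewrite mulnC [l.+1 * _]mulnC.
have [r rE] : exists r, N.+1 - l = r by exists (N.+1 - l).
have NE : N.+1 = l + r by rewrite -rE subnKC.
rewrite rE in sz' *; rewrite factS NE.
(* The factor [l] lets this include [l = 0], where [r <= 1] and both sides vanish. *)
have B1 : l * nonballot N l.-1 * l.+1 = r * r.-1 * N`!.
  case: l lN sz sz' rE NE => [|l] lN sz sz' rE NE.
    rewrite mul0n; have [->|->] : r = 0 \/ r = 1 by lia.
      by rewrite !mul0n.
    by rewrite muln0 mul0n.
  have rE' : N - l = r by move: NE; lia.
  have := IH l; rewrite rE' => <-; [|lia|lia].
  by rewrite mulnCA mulnA mulnAC [l.+1 * _]mulnC.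
have B2 : r * nonballot N l * (l.+1 * l.+2) = r * (r.-1 * r.-1.-1 * N`!).
  case: r rE NE sz' B1 => [|r] rE NE sz' _; first by rewrite !mul0n.
  have rE' : N - l = r by move: NE; lia.
  rewrite -mulnA; congr (_ * _); have := IH l; rewrite rE' => ->; [by []|lia|lia].
have -> : (l * nonballot N l.-1 + r * nonballot N l) * (l.+1 * l.+2) =
   l * nonballot N l.-1 * l.+1 * l.+2 + r * nonballot N l * (l.+1 * l.+2).
  by rewrite mulnDl !mulnA.
rewrite B1 B2; move: (N`!) => F; case: r {B1 B2 rE NE sz'} => [|[|r]]; rewrite /=; nia.
Qed.

End Counting.

(** * From words to the sorting time of a permutation *)

Section SortingBounds.
Local Open Scope nat_scope.
Local Open Scope seq_scope.

Lemma uniq_one_line n (p : 'S_n) : uniq (one_line p).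
Proof. by rewrite (perm_uniq (perm_one_line p)) iota_uniq. Qed.

(** Sorted words are fixed by [stack_sort], so every time after the first success is a success
    too. *)
Lemma sd_leP n (p : 'S_n) t : (sd p <= t) = sorted ltn (iter t stack_sort (one_line p)).
Proof.
have pi k : perm_eq (iter k stack_sort (one_line p)) (iota 1 n).
  elim: k => [|k IH]; first exact: perm_one_line.
  rewrite iterS; apply: perm_trans (IH).
  by apply: perm_stack_sort; rewrite (perm_uniq IH) iota_uniq.
rewrite /sd; case: ex_minnP => m /eqP mE minm; apply/idP/idP => [le|st].
  have sm : sorted ltn (iter m stack_sort (one_line p)).
    by rewrite mE; exact: iota_ltn_sorted.
  by rewrite -(subnK le) iterD sorted_iter_stack_sort_id.
apply: minm; apply/eqP; apply: (irr_sorted_eq ltn_trans ltnn st).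
  exact: iota_ltn_sorted.
exact: perm_mem (pi t).
Qed.

Lemma sd_le_merge_bound n (p : 'S_n) : sd p <= (merge_bound [::] (word p)).+1.
Proof.
rewrite sd_leP -(@merge_bound_invariant S) // -one_lineE.
exact/sorted_merge_bound/uniq_one_line.
Qed.

Definition below_suffix n w := count (fun x => all (ltn x) (drop n w)) (take n w).

Lemma gap_le_sd N (p : 'S_N) n : n < N ->
  gap 0 (take n (word p)) <= sd p + below_suffix n (word p).
Proof.
move=> nN; have := leqnn (sd p); rewrite sd_leP => st.
have := uniq_one_line p.
rewrite -{1}[one_line p](cat_take_drop n) => u.
rewrite -{1}[one_line p](cat_take_drop n) in st.
have vN0 : drop n (one_line p) != [::].
  by rewrite -size_eq0 size_drop one_lineE size_map size_word subn_eq0 -ltnNge.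
have := gap_le_steps u vN0 st; rewrite one_lineE -map_take gap_map // count_map.
move=> /leq_trans; apply; rewrite leq_add2l; apply: sub_count => x /=.
by rewrite -map_drop all_map.
Qed.

(** By symmetry a prefix letter is the smallest among itself and the last [k] letters with
    probability [1 / (k + 1)]; this is summed over [n] positions. *)
Lemma sum_below_suffix k n :
  k.+1 * \sum_(p : 'S_(k + n)) below_suffix n (word p) <= n * (k + n)`!.
Proof.
have nN : n <= k + n by exact: leq_addl.
(* [A i] consists of [i] and the last [k] positions; [mn i j p] below says that [p] takes its
   minimum over [A i] at [j]. *)
pose A (i : 'I_n) := widen_ord nN i |: [set j : 'I_(k + n) | n <= j].
have winj : injective (widen_ord nN) by move=> x y /(congr1 val) /= /val_inj.
have cA i : #|A i| = k.+1.
  rewrite cardsU1 inE -ltnNge /= ltn_ord; congr S.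
  have := cardsC [set j : 'I_(k + n) | n <= j].
  have -> : #|~: [set j : 'I_(k + n) | n <= j]| = n.
    rewrite -[RHS]card_ord -(card_imset _ winj).
    apply: fintype.eq_card => j; rewrite !inE -ltnNge; apply/idP/imsetP.
      2: by move=> [l _ ->]; exact: (ltn_ord l).
    move=> jn.
    by exists (Ordinal jn) => //; apply: val_inj.
  by rewrite card_ord => /eqP; rewrite eqn_add2r => /eqP.
pose mn i (j : 'I_(k + n)) (p : 'S_(k + n)) := [forall l in A i, (l != j) ==> (p j < p l)].
have le1 (p : 'S_(k + n)) : below_suffix n (word p) <= \sum_(i < n) mn i (widen_ord nN i) p.
  rewrite /below_suffix -(map_nth_iota0 0) ?size_word // count_map -sum1_count.
  rewrite big_mkcond /= -[n in iota 0 n]subn0 big_mkord.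
  apply: leq_sum => i _; case: ifP => // /allP h.
  suff -> : mn i (widen_ord nN i) p by [].
  apply/forallP => l; apply/implyP => lA; apply/implyP => li.
  move: lA; rewrite !inE (negPf li) /= => nl.
  rewrite -(nth_word p (widen_ord nN i)) /=; apply: h.
  have -> : (p l : nat) = nth 0 (drop n (word p)) (l - n).
    by rewrite nth_drop subnKC // nth_word.
  apply: mem_nth; rewrite size_drop size_word.
  by have := ltn_ord l; move: nl; clear; lia.
have le2 i : k.+1 * \sum_(p : 'S_(k + n)) mn i (widen_ord nN i) p <= (k + n)`!.
  (* Precomposing with the transposition of [i] and [j] preserves [A i] and exchanges the two
     events. *)
  have sym j : j \in A i -> \sum_(p : 'S_(k + n)) mn i j p =
      \sum_(p : 'S_(k + n)) mn i (widen_ord nN i) p.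
    move=> jA; pose g := tperm (widen_ord nN i) j.
    have gA l : (g l \in A i) = (l \in A i).
      rewrite /g; case: tpermP => [->|->|//]; rewrite ?jA //; by rewrite !inE eqxx.
    have gj : g j = widen_ord nN i by rewrite /g tpermR.
    have gi : g (widen_ord nN i) = j by rewrite /g tpermL.
    have gK l : g (g l) = l by rewrite /g tpermK.
    rewrite (reindex_inj (mulgI g)); apply: eq_bigr => p _; congr nat_of_bool.
    apply/forallP/forallP => h l; have := h (g l); rewrite gA !permM.
      by rewrite gj gK -{1}gi (inj_eq perm_inj).
    by rewrite gj -{1}gj (inj_eq perm_inj).
  rewrite -(cA i) -sum_nat_const -(eq_bigr _ sym) exchange_big /=.
  rewrite -card_Sn -sum1_card; apply: leq_sum => p _.
  (* The minimum is attained at one position only, so the [k + 1] events are disjoint. *)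
  rewrite -big_mkcondr /= sum1_card; apply/card_le1_eqP => j l.
  rewrite !unfold_in => /andP[jA /forallP mj] /andP[lA /forallP ml].
  have {}jA : j \in A i by [].
  have {}lA : l \in A i by [].
  apply/eqP; apply: contraT => jl.
  have := mj l; rewrite lA jl /= => lt1.
  have := ml j; rewrite jA eq_sym jl /= => lt2.
  by have := ltn_trans lt1 lt2; rewrite ltnn.
apply: (@leq_trans (\sum_(i < n) k.+1 * \sum_(p : 'S_(k + n)) mn i (widen_ord nN i) p)).
  rewrite -big_distrr leq_pmul2l //= exchange_big /=.
  by apply: leq_sum => p _; exact: le1.
apply: (@leq_trans (\sum_(i < n) (k + n)`!)); first by apply: leq_sum => i _; exact: le2.
by rewrite sum_nat_const card_ord.
Qed.

(** * Recursion for the total of [merge_bound] *)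

Definition merge_total n : nat := \sum_(p : 'S_n) merge_bound [::] (word p).

Lemma merge_bound_lift_max n (i : 'I_n.+1) (s : 'S_n) :
  merge_bound [::] (word (lift_perm i ord_max s)) =
  i + ~~ `[< ballot (take i (word s)) (drop i (word s)) >] * merge_bound [::] (drop i (word s)).
Proof.
have -> : word (lift_perm i ord_max s) = take i (word s) ++ n :: drop i (word s).
  rewrite word_lift_perm; have -> // : [seq bump n x | x <- word s] = word s.
  rewrite -[RHS]map_id; apply/eq_in_map => x; rewrite mem_word => xn.
  by rewrite /bump leqNgt xn.
have ltn_word : all (gtn n) (word s) by apply/allP => x; rewrite mem_word.
have := ltn_word; rewrite -{1}(cat_take_drop i (word s)) all_cat => /andP[h1 h2].
rewrite merge_bound_split //= !add0n size_takel; last by rewrite size_word -ltnS.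
by case: asboolP => _; rewrite ?mul0n ?mul1n ?addn0.
Qed.

(** The recursive term of [merge_bound] when the maximum stands at position [i]. *)
Definition merge_tail n i : nat :=
  \sum_(s : 'S_n) ~~ `[< ballot (take i (word s)) (drop i (word s)) >] *
                  merge_bound [::] (drop i (word s)).

Lemma merge_totalS n : merge_total n.+1 = \sum_(i < n.+1) (i * n`! + merge_tail n i).
Proof.
rewrite /merge_total (big_lift_perm_r _ ord_max); apply: eq_bigr => i _.
under eq_bigr do rewrite merge_bound_lift_max.
by rewrite big_split /= sum_nat_const card_Sn mulnC.
Qed.

(** Keeps the ballot condition and bounds the tail by its length: the estimate for short right
    parts. *)
Lemma merge_tail_nonballot n i : merge_tail n i <= (n - i) * nonballot n i.
Proof.
rewrite mulnC /nonballot big_distrl /=; apply: leq_sum => s _; rewrite leq_mul2l.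
apply/orP; right; have [->//|N0] := eqVneq (drop i (word s)) [::].
apply: (leq_trans (merge_bound_le _ N0)).
by rewrite add0n (leq_trans (leq_pred _)) // size_drop size_word.
Qed.

(** Forgets the ballot condition, so that the right part is in uniformly random order: the estimate
    for long right parts. *)
Lemma merge_tail_total n i : i <= n ->
  (n - i)`! * merge_tail n i <= n`! * merge_total (n - i).
Proof.
move=> le; have := @sum_word_drop i (n - i) _ merge_bound_invariant.
rewrite subnKC // -/(merge_total _) => <-; rewrite leq_mul2l; apply/orP; right.
by apply: leq_sum => s _; case: (~~ _); rewrite ?mul1n ?mul0n.
Qed.

Lemma merge_total_le n : merge_total n <= n * n`!.
Proof.
rewrite mulnC -[X in X * _]card_Sn -sum_nat_const; apply: leq_sum => p _.
have [->//|N0] := eqVneq (word p) [::].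
apply: (leq_trans (merge_bound_le _ N0)).
by rewrite add0n (leq_trans (leq_pred _)) // size_word.
Qed.

End SortingBounds.

(** * Means as real numbers, and a sum compared with an integral *)

Section Averages.
Variable R : realType.
Local Open Scope ring_scope.
Local Open Scope classical_set_scope.

Lemma limn_esup_le_near (u : nat -> \bar R) (c : \bar R) n0 :
  (forall n, (n0 <= n)%N -> (u n <= c)%E) -> (limn_esup u <= c)%E.
Proof.
move=> h; apply: (@le_trans _ _ (ereal_sup (u @` [set n | (n0 <= n)%N]))).
  by apply: ereal_inf_lbound; exists [set n | (n0 <= n)%N] => //; exists n0.
by apply: ge_ereal_sup => _ [n /= nn0 <-]; exact: h.
Qed.

Lemma limn_einf_ge_near (u : nat -> \bar R) (c : \bar R) n0 :
  (forall n, (n0 <= n)%N -> (c <= u n)%E) -> (c <= limn_einf u)%E.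
Proof.
move=> h; rewrite /limn_einf leeNr; apply: (@limn_esup_le_near _ _ n0) => n nn0.
by rewrite leeN2; exact: h.
Qed.

Lemma natr_fact_gt0 n : 0 < (n`!)%:R :> R.
Proof. by rewrite ltr0n fact_gt0. Qed.

Lemma perm_mean_le n (f g : 'S_n -> nat) :
  (\sum_p f p <= \sum_p g p)%N -> perm_mean R f <= perm_mean R g.
Proof.
move=> h; rewrite /perm_mean ler_pM2l ?invr_gt0 ?natr_fact_gt0 //.
by rewrite -!natr_sum ler_nat.
Qed.

Definition merge_mean n : R := (merge_total n)%:R / (n`!)%:R.

Lemma avg_sd_le_merge n : avg_sd R n <= merge_mean n + 1.
Proof.
apply: (@le_trans _ _ (perm_mean R (fun p : 'S_n => (merge_bound [::] (word p)).+1))).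
  by apply: perm_mean_le; apply: leq_sum => p _; exact: sd_le_merge_bound.
rewrite /perm_mean -natr_sum.
have -> : (\sum_(p : 'S_n) (merge_bound [::] (word p)).+1 = merge_total n + n`!)%N.
  rewrite -card_Sn -sum1_card -big_split /=; apply: eq_bigr => p _; exact: (esym (addn1 _)).
rewrite natrD mulrDr mulVf ?gt_eqF ?natr_fact_gt0 //.
by rewrite mulrC.
Qed.

Definition tail_mean n i : R := (merge_tail n i)%:R / (n`!)%:R.

Lemma merge_meanS n :
  n.+1%:R * merge_mean n.+1 = \sum_(0 <= i < n.+1) (i%:R + tail_mean n i).
Proof.
have f0 : (n`!)%:R != 0 :> R by rewrite gt_eqF ?natr_fact_gt0.
have n0 : n.+1%:R != 0 :> R by rewrite pnatr_eq0.
rewrite /merge_mean merge_totalS factS natrM invfM mulrCA mulVKf //.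
rewrite big_mkord natr_sum mulr_suml; apply: eq_bigr => i _.
by rewrite natrD natrM /tail_mean; field.
Qed.

Lemma tail_mean_le_mean n i : (i <= n)%N -> tail_mean n i <= merge_mean (n - i).
Proof.
move=> le; rewrite /tail_mean /merge_mean ler_pdivrMr ?natr_fact_gt0 //.
rewrite mulrAC ler_pdivlMr ?natr_fact_gt0 // -!natrM ler_nat.
by rewrite mulnC [(merge_total _ * _)%N]mulnC; exact: merge_tail_total.
Qed.

(** The right length [r] times the failure probability is relaxed to [r^3 / (i + 1)^2], with [r]
    written through [N = n + 1] and [i + 1] to match the integrand [(N - x)^3 / x^2]. *)
Lemma tail_mean_le_cube n i : (i <= n)%N -> (n - i <= i)%N ->
  tail_mean n i <= (n.+1%:R - i.+1%:R) ^+ 3 / i.+1%:R ^+ 2.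
Proof.
move=> le sz; rewrite -natrB // subSS; set r := (n - i)%N.
have := @nonballotE n i le (leq_trans sz (leqW (leqnSn _))); rewrite -/r => nbE.
rewrite /tail_mean ler_pdivrMr ?natr_fact_gt0 // mulrAC ler_pdivlMr ?exprn_gt0 ?ltr0n //.
rewrite -!natrX -!natrM ler_nat.
apply: (@leq_trans (r * (nonballot n i * (i.+1 * i.+2)))%N).
  rewrite mulnA leq_mul ?merge_tail_nonballot // expnS expn1 leq_mul //.
rewrite nbE; have -> : (r ^ 3 * n`! = r * (r * r * n`!))%N by rewrite !expnS expn0; lia.
by rewrite leq_mul // leq_mul // leq_mul // leq_pred.
Qed.

(* A primitive of [(N - x)^3 / x^2] up to lower order terms: the argument of [ln]
   is shifted so that [cube_le_telescope] holds term by term. *)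
Definition riemann_primitive (N : R) (i : nat) : R :=
  - (N ^+ 3 / i%:R) - 3 * N ^+ 2 * ln (i.+1%:R) + 3 * N * i%:R - i%:R * i.+1%:R / 2.

Lemma cube_le_telescope (N : R) (i : nat) : (0 < i)%N -> 0 <= N ->
  (N - i.+1%:R) ^+ 3 / i.+1%:R ^+ 2 <=
    riemann_primitive N i.+1 - riemann_primitive N i.
Proof.
move=> i0 N0; rewrite /riemann_primitive.
have x0 : 0 < i%:R :> R by rewrite ltr0n.
have -> : i.+2%:R = i%:R + 2 :> R by rewrite -addn2 natrD.
have -> : i.+1%:R = i%:R + 1 :> R by rewrite -addn1 natrD.
move: (i%:R : R) x0 => x x0.
(* The logarithm has a negative coefficient in the primitive, so its increment is needed from above;
   the shift makes [1 / (x + 1)] a bound. *)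
have lnle : ln (x + 2) - ln (x + 1) <= (x + 1)^-1.
  have -> : x + 2 = (1 + (x + 1)^-1) * (x + 1) by field; lra.
  have p1 : 0 < (x + 1)^-1 by rewrite invr_gt0; lra.
  rewrite lnM ?posrE; [|lra|lra].
  by have := @le_ln1Dx R (x + 1)^-1; lra.
have sq : N ^+ 3 * ((x + 1) ^+ 2)^-1 <= N ^+ 3 * (x^-1 - (x + 1)^-1).
  apply: ler_wpM2l; first exact: exprn_ge0.
  have -> : x^-1 - (x + 1)^-1 = (x * (x + 1))^-1 by field; lra.
  by rewrite lef_pV2 ?posrE; nra.
have ln3 : 3 * N ^+ 2 * (ln (x + 2) - ln (x + 1)) <= 3 * N ^+ 2 * (x + 1)^-1.
  by apply: ler_wpM2l => //; nra.
have -> : (N - (x + 1)) ^+ 3 / (x + 1) ^+ 2 =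
    N ^+ 3 * ((x + 1) ^+ 2)^-1 - 3 * N ^+ 2 * (x + 1)^-1 + 3 * N - (x + 1) by field; lra.
have -> : x * (x + 1) / 2 = (x ^+ 2 + x) / 2 by ring.
have -> : (x + 1) * (x + 2) / 2 = (x ^+ 2 + 3 * x + 2) / 2 by ring.
move: sq ln3; rewrite !mulrBr => sq ln3.
by rewrite mulrDr mulr1; lra.
Qed.

End Averages.

(** * Asymptotic bounds for the mean sorting time *)

Section Limits.
Variable R : realType.
Local Open Scope ring_scope.
Local Open Scope classical_set_scope.

(** Any bound below [7 / 8] serves: it makes the constant [3 / 5 * (7 - 8 * ln 2)] nonnegative. *)
Lemma ln2_le : ln 2 <= 5 / 6 :> R.
Proof.
have -> : 2 = (1 + 1 / 3) * (1 + 1 / 2) :> R by field.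
rewrite lnM ?posrE; [|lra|lra].
have := @le_ln1Dx R (1 / 3); have := @le_ln1Dx R (1 / 2); lra.
Qed.

(** [17 / 8 - 3 ln 2] is the integral of [(1 - x)^3 / x^2] over [[1/2, 1]]; the linear term absorbs
    the rounding of [N / 2] to [m] and the shifts in [riemann_primitive]. *)
Lemma sum_cube_le (N m : nat) : (2 <= N)%N -> (m.*2 <= N)%N -> (N <= m.*2.+1)%N ->
  \sum_(m <= i < N) ((N%:R - i.+1%:R) ^+ 3 / i.+1%:R ^+ 2 : R) <=
    N%:R ^+ 2 * (17 / 8 - 3 * ln 2) + 9 * N%:R.
Proof.
move=> N2 mN Nm.
have m0 : (0 < m)%N by lia.
have leN : (m <= N)%N by lia.
apply: (@le_trans _ _ (riemann_primitive N%:R N - riemann_primitive N%:R m)).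
  rewrite -telescope_sumr //; apply: ler_sum_nat => i /andP[mi _].
  by apply: cube_le_telescope => //; exact: leq_trans mi.
have x2 : 2 <= N%:R :> R by rewrite ler_nat.
have y0 : 1 <= m%:R :> R by rewrite ler1n.
have yx : 2 * m%:R <= N%:R :> R by rewrite -natrM ler_nat; lia.
have xy : N%:R <= 2 * m%:R + 1 :> R by rewrite -natrM natr1 ler_nat; lia.
rewrite /riemann_primitive -[N.+1%:R]natr1 -[m.+1%:R]natr1.
move: (N%:R : R) (m%:R : R) x2 y0 yx xy => x y x2 y1 yx xy.
have lny : ln (y + 1) + ln 2 <= ln (x + 1) + (x + 1)^-1.
  have p1 : 0 < (x + 1)^-1 by rewrite invr_gt0; lra.
  apply: (@le_trans _ _ (ln (x + 2))).
    rewrite -lnM ?posrE; [|lra|lra].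
    by rewrite ler_ln ?posrE; lra.
  have -> : x + 2 = (x + 1) * (1 + (x + 1)^-1) by field; lra.
  rewrite lnM ?posrE; [|lra|lra].
  by rewrite lerD2l le_ln1Dx //; lra.
have h1 : x ^+ 3 / y <= 2 * x ^+ 2 + 4 * x by rewrite ler_pdivrMr; [nra|lra].
have h2 : x ^+ 3 / x = x ^+ 2 by field; lra.
have h3 : 3 * x ^+ 2 * (ln (y + 1) + ln 2) <= 3 * x ^+ 2 * ln (x + 1) + 3 * x.
  apply: (@le_trans _ _ (3 * x ^+ 2 * (ln (x + 1) + (x + 1)^-1))).
    by apply: ler_wpM2l => //; nra.
  rewrite mulrDr lerD2l ler_pdivrMr; [nra|lra].
have h4 : 3 * x * x - 3 * x * y <= 3 / 2 * x ^+ 2 + 3 / 2 * x by nra.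
have h5 : y * (y + 1) / 2 <= x ^+ 2 / 8 + x / 4 by nra.
rewrite h2; move: h3; rewrite mulrDr => h3.
have -> : x * (x + 1) / 2 = x ^+ 2 / 2 + x / 2 by ring.
have -> : x ^+ 2 * (17 / 8 - 3 * ln 2) = 17 / 8 * x ^+ 2 - 3 * x ^+ 2 * ln 2 by ring.
lra.
Qed.

Lemma sum_id_nat (n : nat) : \sum_(0 <= i < n) (i%:R : R) = n%:R * (n%:R - 1) / 2.
Proof.
elim: n => [|n IH]; first by rewrite big_nil mul0r mul0r.
by rewrite big_nat_recr //= IH -[n.+1%:R]natr1; field.
Qed.

Local Notation K := (3 / 5 * (7 - 8 * ln 2) : R).

(** Positions [i < N / 2] use the inductive bound and the others the ballot estimate. The
    coefficients of [N^2] give [K = 1/2 + 3/8 K + (17/8 - 3 ln 2)], which determines [K]. The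
    constant 18 reproduces itself because [18 m <= 9 N] and [sum_cube_le] adds another [9 N]. *)
Lemma merge_mean_le n : merge_mean R n <= K * n%:R + 18.
Proof.
have K0 : 0 <= K by have := ln2_le; lra.
elim/ltn_ind: n => -[|[|n]] IH.
- have m0 : merge_total 0 = 0%N by have := merge_total_le 0; lia.
  by rewrite /merge_mean m0 mul0r; lra.
- have : (merge_total 1)%:R <= 1 :> R by rewrite lern1; exact: (merge_total_le 1).
  rewrite /merge_mean.
  by rewrite (_ : 1`! = 1%N) // divr1; lra.
set N := n.+2 in IH *; set m := N./2.
have mN : (m.*2 <= N)%N by rewrite /m; lia.
have Nm : (N <= m.*2.+1)%N by rewrite /m; lia.
have m1 : (1 <= m)%N by rewrite /m /N; lia.
have leN : (m <= N)%N by lia.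
rewrite -(ler_pM2l (_ : 0 < N%:R)); last by rewrite ltr0n.
rewrite merge_meanS big_split /= sum_id_nat.
rewrite (big_cat_nat _ leN) //= -/N.
have S2 : \sum_(m <= i < N) tail_mean R n.+1 i <= N%:R ^+ 2 * (17 / 8 - 3 * ln 2) + 9 * N%:R.
  apply: le_trans (@sum_cube_le N m _ mN Nm) => //.
  apply: ler_sum_nat => i /andP[mi iN]; apply: tail_mean_le_cube; first by [].
  by rewrite /N in Nm; lia.
have S1 : \sum_(0 <= i < m) tail_mean R n.+1 i <=
    \sum_(0 <= i < m) (K * (N%:R - 1) + 18 - K * i%:R).
  apply: ler_sum_nat => i /andP[_ im].
  have iN : (i <= n.+1)%N by rewrite /N in leN; lia.
  apply: (le_trans (tail_mean_le_mean R iN)); apply: (le_trans (IH _ _)); first by rewrite /N; lia.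
  by rewrite natrB // /N -[n.+2%:R]natr1; lra.
have S1E : \sum_(0 <= i < m) (K * (N%:R - 1) + 18 - K * i%:R) =
    m%:R * (K * (N%:R - 1) + 18) - K * (m%:R * (m%:R - 1) / 2).
  by rewrite big_split /= sumr_const_nat subn0 sumrN -mulr_sumr sum_id_nat -[X in X - _]mulr_natl.
rewrite S1E in S1.
have yx : 2 * m%:R <= N%:R :> R by rewrite -natrM ler_nat; lia.
have xy : N%:R <= 2 * m%:R + 1 :> R by rewrite -natrM natr1 ler_nat; lia.
have y1 : 1 <= m%:R :> R by rewrite ler1n.
move: S1 S2; move: (\sum_(0 <= i < m) _) (\sum_(m <= i < N) _) => s1 s2.
have KE : 17 / 8 - 3 * ln 2 = 5 / 8 * K - 1 / 2 by field.
rewrite KE; move: (K) K0 (N%:R : R) (m%:R : R) y1 yx xy {KE S1E} => k k0 x y y1 yx xy S1 S2.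
have h : y * (x - 1) - y * (y - 1) / 2 <= 3 / 8 * x ^+ 2 by nra.
have hk : k * (y * (x - 1) - y * (y - 1) / 2) <= k * (3 / 8 * x ^+ 2) by apply: ler_wpM2l.
nra.
Qed.

(** Averages [gap_le_sd] over ['S_(k + n)]: the prefix of length [n] has the mean gap of ['S_n],
    hence the mean longest cycle, and the loss is at most [n / (k + 1)]. *)
Lemma avg_sd_ge k n : (0 < k)%N ->
  avg_longest_cycle R n - n%:R / k.+1%:R <= avg_sd R (k + n).
Proof.
move=> k0.
have le : (\sum_(p : 'S_(k + n)) gap 0 (take n (word p)) <=
    \sum_(p : 'S_(k + n)) sd p + \sum_(p : 'S_(k + n)) below_suffix n (word p))%N.
  by rewrite -big_split; apply: leq_sum => p _; apply: gap_le_sd; lia.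
have tk := @sum_word_take k n _ (gap_invariant 0).
have bl := sum_below_suffix k n.
rewrite /avg_longest_cycle /avg_sd /perm_mean -!natr_sum sum_longest_cycle.
move: le tk bl; set G := (\sum_(p : 'S_(k + n)) gap _ _)%N; set S := (\sum_p sd p)%N.
set B := (\sum_(p : 'S_(k + n)) below_suffix _ _)%N; set A := (\sum_p gap _ _)%N => le tk bl.
have f0 := natr_fact_gt0 R n; have F0 := natr_fact_gt0 R (k + n).
have k1 : 0 < k.+1%:R :> R by rewrite ltr0n.
have leR : G%:R <= S%:R + B%:R :> R by rewrite -natrD ler_nat.
have tkR : (n`!)%:R * G%:R = ((k + n)`!)%:R * A%:R :> R by rewrite -!natrM tk.
have blR : k.+1%:R * B%:R <= n%:R * ((k + n)`!)%:R :> R by rewrite -!natrM ler_nat.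
have -> : (n`!)%:R^-1 * A%:R = ((k + n)`!)%:R^-1 * G%:R :> R.
  have -> : G%:R = (n`!)%:R^-1 * (((k + n)`!)%:R * A%:R) :> R by rewrite -tkR mulKf // gt_eqF.
  by rewrite mulrCA mulKf // gt_eqF.
rewrite lerBlDl -[n%:R / _](mulKf (_ : ((k + n)`!)%:R != 0)) ?gt_eqF //.
rewrite -mulrDr ler_pM2l ?invr_gt0 //.
apply: (le_trans leR); rewrite addrC lerD2r mulrA ler_pdivlMr //.
by rewrite mulrC [_ * n%:R]mulrC.
Qed.

Lemma avg_longest_cycle_le n : avg_longest_cycle R n <= n%:R.
Proof.
rewrite /avg_longest_cycle /perm_mean -natr_sum mulrC ler_pdivrMr ?natr_fact_gt0 //.
rewrite -natrM ler_nat sum_longest_cycle -card_Sn mulnC -sum_nat_const.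
by apply: leq_sum => p _; apply: (leq_trans (gap_le_size _ _)); rewrite add0n size_word.
Qed.

Lemma avg_sd_ge0 n : 0 <= avg_sd R n.
Proof. by rewrite mulr_ge0 ?invr_ge0 ?ler0n // sumr_ge0. Qed.

Lemma golomb_dickman_le :
  ((golomb_dickman R)%:E <= limn_einf (fun n : nat => (avg_sd R n / n%:R)%:E))%E.
Proof.
rewrite /golomb_dickman; set u := fun n => _ / _.
have [cu|ncu] := pselect (cvgn u); last first.
  (* [limn] of a divergent sequence is the default value [0]. *)
  have -> : limn u = 0.
    rewrite /lim /lim_in xgetPN // => l ul; apply: ncu; apply/cvg_ex.
    by exists l.
  by apply: (@limn_einf_ge_near _ _ _ 0) => n _; rewrite lee_fin divr_ge0 ?avg_sd_ge0.
set l := limn u; have ul : u @ \oo --> l by [].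
apply/lee_addgt0Pr => e e0.
(* Each third pays for one loss: the distance of [u n] from its limit, the term [1 / (k + 1)], and
   the [k] letters cut off from [N]. *)
pose d := e / 3; have d0 : 0 < d by rewrite divr_gt0.
pose k := (Num.truncn d^-1).+1.
have kd : k.+1%:R^-1 <= d.
  rewrite -[leRHS]invrK lef_pV2 ?posrE ?invr_gt0 ?ltr0n //.
  apply: ltW; apply: (lt_le_trans (truncnS_gt _)); by rewrite ler_nat.
move/cvgrPdist_lt: ul => /(_ d d0) [n1 _ near1].
pose n2 := (Num.truncn (k%:R / d)).+1.
rewrite -leeBlDr //.
apply: (@limn_einf_ge_near _ _ _ (n1 + n2 + k)%N) => N leN.
rewrite lee_fin lerBlDr.
have [n NE] : exists n, N = (k + n)%N by exists (N - k)%N; rewrite subnKC //; lia.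
have n1n : (n1 <= n)%N by lia.
have n2n : (n2 <= n)%N by lia.
have n0 : 0 < n%:R :> R by rewrite ltr0n /n2 in n2n *; lia.
have N0 : 0 < N%:R :> R by rewrite ltr0n; lia.
have := near1 _ n1n; rewrite /= => /ltr_normlW; rewrite ltrBlDr => ln.
have lb := @avg_sd_ge k n isT; rewrite -NE in lb.
have kN : k%:R <= d * N%:R.
  rewrite mulrC -ler_pdivrMr //; apply: ltW; apply: (lt_le_trans (truncnS_gt _)).
  by rewrite ler_nat NE (leq_trans n2n) // leq_addl.
have lle : l <= u n + d by lra.
have NR : N%:R = k%:R + n%:R :> R by rewrite NE natrD.
have k0 : 0 <= k%:R :> R by [].
have un1 : u n <= 1 by rewrite /u ler_pdivrMr // mul1r avg_longest_cycle_le.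
have uE : avg_longest_cycle R n = u n * n%:R by rewrite /u divfK // gt_eqF.
rewrite uE in lb.
have dk : n%:R / k.+1%:R <= d * N%:R.
  by apply: (@le_trans _ _ (n%:R * d)); [apply: ler_wpM2l|rewrite NR; nra].
have eE : e = 3 * d by rewrite /d; field.
suff : (l - e) * N%:R <= avg_sd R N by rewrite -ler_pdivlMr //; lra.
have h1 : l * N%:R <= (u n + d) * N%:R by apply: ler_wpM2r => //; exact: ltW.
have h2 : u n * N%:R <= u n * n%:R + k%:R by rewrite NR; nra.
rewrite eE; move: h1 h2 kN lb dk.
move: (u n) (n%:R : R) (N%:R : R) (avg_sd R N) (n%:R / k.+1%:R) (k%:R : R) (l) (d) => u0 x y a q z l0 d1 h1 h2 h3 h4 h5.
by clear -h1 h2 h3 h4 h5; lra.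
Qed.

Lemma limn_esup_avg_sd_le :
  (limn_esup (fun n : nat => (avg_sd R n / n%:R)%:E) <= K%:E)%E.
Proof.
apply/lee_addgt0Pr => e e0.
(* 19 is the 18 of [merge_mean_le] plus the first pass. *)
apply: (@limn_esup_le_near _ _ _ (Num.truncn (19 / e)).+1) => n nn0.
have n0 : 0 < n%:R :> R by rewrite ltr0n; lia.
rewrite -EFinD lee_fin ler_pdivrMr // mulrDl.
have := avg_sd_le_merge R n; have := merge_mean_le n.
have : 19 <= e * n%:R.
  rewrite mulrC -ler_pdivrMr //; apply: ltW; apply: (lt_le_trans (truncnS_gt _)).
  by rewrite ler_nat.
lra.
Qed.

End Limits.

Local Open Scope ring_scope.

Theorem theorem1p1 (R : realType) :
  [/\ ((golomb_dickman R)%:E <=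
        limn_einf (fun n : nat => (avg_sd R n / n%:R)%:E))%E,
      (limn_einf (fun n : nat => (avg_sd R n / n%:R)%:E) <=
        limn_esup (fun n : nat => (avg_sd R n / n%:R)%:E))%E
    & (limn_esup (fun n : nat => (avg_sd R n / n%:R)%:E) <=
        (3 / 5 * (7 - 8 * ln 2))%:E)%E].
Proof.
split; [exact: golomb_dickman_le|exact: limn_einf_sup|exact: limn_esup_avg_sd_le].
Qed.
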